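(* Let $G$ be a finite simple graph with $m$ edges and maximum degree $\Delta$. Let $X$ be the number of crossings in a uniformly random embedding of $G$, let $\mu = E(X)$, $\sigma^2 = \mathrm{Var}(X)$, and assume $\sigma > 0$. Let $W = \frac{X-\mu}{\sigma}$ and let $Z$ be a standard normal random variable. Then: (1) if $\Delta \in \{1,2\}$, $$d_K(W,Z) \le \frac{1}{\sqrt{m}}\left(60(1+9\sqrt{5})\Delta^2 + 600\,\Delta\right);$$ (2) if $\Delta \ge 3$, $$d_K(W,Z) \le \frac{1}{\sqrt{m}}\left(120(1+9\sqrt{10})\Delta^2 + 1200\,\Delta\right).$$
   Context: Let $G=(V,E)$ be a finite simple graph with vertex set $V=[n]=\{1,\dots,n\}$. For a permutation $\pi\in S_n$, the embedding $G_\pi$ is the graph on $[n]$ in which $(\pi(v),\pi(w))$ is an edge if and only if $(v,w)\in E$ (the vertices $1,\dots,n$ are thought of as placed in this order on a circle). A crossing in $G_\pi$ is a quadruple $(a,b,c,d)$ of vertices with $(a,b),(c,d)\in E$ and $\pi(a)>\pi(c)>\pi(b)>\pi(d)$. A uniformly random embedding of $G$ is $G_\pi$ with $\pi$ uniformly random in $S_n$. The Kolmogorov distance between real random variables $X,Y$ is $d_K(X,Y)=\sup_{x\in\mathbb{R}}|P(X\le x)-P(Y\le x)|$. *)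

(* Defs.v *)
From HB Require Import structures.
From mathcomp Require Import all_boot all_order all_algebra fingroup perm.
From mathcomp Require Import all_classical all_reals all_analysis.

Set Implicit Arguments.
Unset Strict Implicit.
Unset Printing Implicit Defensive.

Import Order.TTheory GRing.Theory Num.Theory.
Import numFieldNormedType.Exports.

Local Open Scope classical_set_scope.
Local Open Scope ring_scope.

(* Permutations carry the discrete sigma-algebra, so that a random permutation
   is a random variable in the sense of the library. *)
HB.instance Definition _ (T : finType) := isPointed.Build (perm_type T) 1%g.

HB.instance Definition _ (T : finType) :=
  @isMeasurable.Build default_measure_display (perm_type T)
    discrete_measurable discrete_measurable0
    discrete_measurableC discrete_measurableU.

Section graph.
Context {n : nat} (e : rel 'I_n).

Definition edges : {set {set 'I_n}} :=
  [set [set p.1; p.2]%SET | p : 'I_n * 'I_n & e p.1 p.2]%SET.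

Definition degree (v : 'I_n) : nat := #|[set w | e v w]%SET|.

Definition max_degree : nat := \max_(v : 'I_n) degree v.

(* The chain p a > p c > p b > p d fixes the order of the two edges and of their
   endpoints, so each pair of crossing chords is counted exactly once. *)
Definition crossing (p : 'S_n) (q : 'I_n * 'I_n * 'I_n * 'I_n) : bool :=
  let: (a, b, c, d) := q in
  [&& e a b, e c d, (p c < p a)%N, (p b < p c)%N & (p d < p b)%N].

Definition crossings (p : 'S_n) : nat := #|[set q | crossing p q]%SET|.

End graph.

Section probability.
Context {R : realType}.

Definition uniform_permutation {d} {Omega : measurableType d}
    (P : probability Omega R) {n : nat} (p : {RV P >-> 'S_n}) : Prop :=
  forall s : 'S_n, distribution P p [set s] = (n`!%:R^-1)%:E.

Definition standard_normal {d} {Omega : measurableType d}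
    (P : probability Omega R) (Z : {RV P >-> R}) : Prop :=
  forall A : set R, measurable A -> distribution P Z A = normal_prob 0 1 A.

(* Meant for measurable X and Y. *)
Definition kolmogorov_distance {d1 d2}
    {Omega1 : measurableType d1} {Omega2 : measurableType d2}
    (P : probability Omega1 R) (Q : probability Omega2 R)
    (X : Omega1 -> R) (Y : Omega2 -> R) : R :=
  sup [set `|fine (P [set w | X w <= x]) - fine (Q [set w | Y w <= x])|
      | x in [set: R]].

End probability.

(* Main.v *)
Require Import Defs.
From HB Require Import structures.
From mathcomp Require Import all_boot all_order all_algebra fingroup perm.
From mathcomp Require Import all_classical all_reals all_analysis.
From mathcomp Require Import measurable_realfun.
From mathcomp Require Import ring lra zify.

Set Implicit Arguments.
Unset Strict Implicit.
Unset Printing Implicit Defensive.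

Import Order.TTheory GRing.Theory Num.Theory.
Import numFieldNormedType.Exports.

Local Open Scope classical_set_scope.
Local Open Scope ring_scope.

(** Why the theorem is true.  Give the vertices independent uniform positions
    [u v] on a discrete circle with [N.+1] points.  When the positions are
    distinct their relative order is a uniform permutation, and coincidences
    have probability at most [n ^ 2 / N.+1]; so the crossing number [X] of the
    random permutation is the limit in law, as [N] grows, of the number of
    strict crossings on the circle.  On the circle [X] is a function of
    independent variables and a sum of terms each depending on four of them,
    which makes the following argument available.

    Normal approximation ([stein_bound]).  Resampling the position of one
    vertex [v] turns [W] into an exchangeable copy [W'].  Write [D_v] for the
    operator [residual v], identity minus averaging over the position of [v].
    If [W] lay in the span of the functions of two positions of the Hoeffding
    decomposition, [\sum_v D_v W] would be [2 * W]; the defect is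
    [regression_error].  Stein's equation and exchangeability then bound the
    Kolmogorov distance by the fluctuations of the two statistics
    [\sum_v E'[(W - W')^2]] and [\sum_v E'[(W - W') * |W - W'|]] and by the
    size of the defect.  The discontinuity of the derivative of the Stein
    solution costs no concentration inequality: the integrands are monotone,
    and exchangeability cancels the symmetric part of the error
    ([stein_jump]; the idea is due to Shao and Zhang).

    The two statistics have small variance by the Efron-Stein inequality:
    moving [v] changes [X] by at most [deg v * m], and the second difference
    in [v], [w] is at most [2 * (deg v * deg w + m * adj (v, w))]
    ([grid_jump_variance]).  The defect is small because the circle is
    homogeneous: [X] has no component depending on a single position, so the
    Hoeffding components left in [\sum_v D_v X - 2 * (X - E X)] have order
    three and four; applying Efron-Stein three times bounds it by third
    differences, which involve only pairs of edges through three prescribed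
    vertices ([regression_third_order], [grid_regression]).

    The variance of [X] is at least [m ^ 3 / 81] when [m] is large compared
    with [Delta ^ 4] ([grid_variance]): by Cauchy-Schwarz it suffices that [X]
    correlates with the sum over the edges of a sign telling whether the
    endpoints are far apart on the circle.  The signs of different edges are
    uncorrelated, and a crossing correlates with the signs of its own edges.

    Together these give the bound [1377 * Delta ^ 2 / sqrt m], which is below
    both bounds of the theorem; when [m < 1000 * Delta ^ 4] it exceeds one and
    the inequality is trivial. *)

(** * Monotonicity from derivatives *)
Section calculus.
Context {R : realType}.
Implicit Types (f df : R -> R).

Lemma is_derive1_continuous f df : (forall x : R, is_derive x (1 : R) f (df x)) ->
  continuous f.
Proof.
by move=> d x; apply/differentiable_continuous/derivable1_diffP/ex_derive.
Qed.

Lemma mean_value f df (a b : R) : (forall x : R, is_derive x (1 : R) f (df x)) ->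
  a <= b -> exists c, [/\ a <= c, c <= b & f b - f a = df c * (b - a)].
Proof.
move=> d ab; have dab x : x \in `]a, b[ -> is_derive x (1 : R) f (df x) by [].
have cab := @continuous_subspaceT _ _ `[a, b] f (is_derive1_continuous d).
have [c cb E] := MVT_segment ab dab cab.
by exists c; move: cb; rewrite in_itv /= => /andP[].
Qed.

Lemma ge0_derive_nondecr f df (a b : R) :
  (forall x : R, is_derive x (1 : R) f (df x)) ->
  (forall x, a <= x -> x <= b -> 0 <= df x) -> a <= b -> f a <= f b.
Proof.
move=> d d0 ab; have [c [ac cb E]] := mean_value d ab.
by rewrite -subr_ge0 E mulr_ge0 ?subr_ge0 ?d0.
Qed.

(** The form in which tail estimates are proved below: a function decreasing to
    its limit zero is nonnegative, so no improper integral is needed. *)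
Lemma le0_derive_tail_ge0 f df (a : R) :
  (forall x : R, is_derive x (1 : R) f (df x)) ->
  (forall x, a <= x -> df x <= 0) -> f x @[x --> +oo] --> (0 : R) -> 0 <= f a.
Proof.
move=> d d0 f0; rewrite -(cvg_lim (@Rhausdorff R) f0).
apply: limr_le; [exact: cvgP f0|].
near=> x.
have ax : a <= x by near: x; apply: nbhs_pinfty_ge; exact: num_real.
have [c [ac cx E]] := mean_value d ax.
by rewrite -subr_le0 E mulr_le0_ge0 ?subr_ge0 ?d0.
Unshelve. all: by end_near. Qed.

End calculus.

(** * The normal distribution function and the Mills ratio *)
Section gaussian.
Context {R : realType}.
Local Notation mu := (@lebesgue_measure R).
Implicit Types x w z : R.

Definition phi x : R := normal_pdf 0 1 x.
Definition Phi x : R := fine (normal_prob 0 1 `]-oo, x] : \bar R).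
Definition mills x : R := (1 - Phi x) / phi x.

Lemma phiE x : phi x = normal_peak 1 * expR (- x ^+ 2 / 2).
Proof.
rewrite /phi normal_pdfE ?oner_eq0 //; congr (_ * expR _).
by rewrite subr0 expr1n.
Qed.

Lemma phi_gt0 x : 0 < phi x.
Proof. by rewrite phiE mulr_gt0 ?expR_gt0 // normal_peak_gt0 ?oner_eq0. Qed.

Lemma phiN x : phi (- x) = phi x.
Proof. by rewrite !phiE sqrrN. Qed.

(** A crude numerical value, from [pi < 4]; it only serves to bound [mills 0]. *)
Lemma phi0_ge : 4^-1 <= phi 0.
Proof.
rewrite phiE expr0n /= oppr0 mul0r expR0 mulr1 /normal_peak expr1n mul1r.
have p4 : (pi : R) <= 4.
  by have := @pihalf_lt2 R; rewrite ltr_pdivrMr //; lra.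
have pp := @pi_gt0 R.
rewrite lef_pV2 ?posrE ?sqrtr_gt0 //; last by rewrite mulr2n; lra.
rewrite -[leRHS]ger0_norm // -sqrtr_sqr ler_sqrt // mulr2n.
by rewrite expr2; lra.
Qed.

Lemma is_derive_phi x : is_derive x (1 : R) phi (- x * phi x).
Proof.
have -> : phi = fun x => normal_peak 1 * expR (- x ^+ 2 / 2).
  by apply/funext => y; rewrite phiE.
apply: is_derive_eq.
rewrite /GRing.scale /=; lra.
Qed.

Lemma cvg_phi : phi x @[x --> +oo] --> (0 : R).
Proof.
have -> : phi = (cst (normal_peak 1 : R)) \* (fun x => expR (- (2^-1 * x ^+ 2))).
  by apply/funext => y; rewrite phiE /=; congr (_ * expR _); lra.
rewrite -[X in _ --> X](mulr0 (normal_peak 1)).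
apply: cvgM; first exact: cvg_cst.
apply: (cvg_comp (fun x => 2^-1 * x ^+ 2) (fun x => expR (- x))).
  have q0 : 0 < 2^-1 :> R by lra.
  exact: (gt0_cvgMry q0 cvgr_expr2).
exact: cvgr_expR.
Qed.

Lemma is_derive_Phi x : is_derive x (1 : R) Phi (phi x).
Proof.
have x1 : x < x + 1 by rewrite ltrDl.
have phi_int : mu.-integrable `]-oo, x + 1] (EFin \o phi).
  exact: (integrableS _ _ _ (@integrable_normal_pdf R 0 1)).
have phi_cont : {for x, continuous phi}.
  by apply: continuous_normal_pdf; rewrite oner_eq0.
have PhiI : Phi = fun y => \int[mu]_(t in `]-oo, y]) phi t by [].
rewrite PhiI.
have [d1 d2] := @continuous_FTC1 R phi (BInfty _ true) x _ x1 phi_int (ltNyr _) phi_cont.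
by apply: DeriveDef; [exact: d1|rewrite -derive1E; exact: d2].
Qed.

(** The identity as a random variable, whose law is the normal law: [Phi] then
    inherits the limits at infinity of cumulative distribution functions. *)
Let idR : measurableTypeR R -> R := idfun.
HB.instance Definition _ :=
  @isMeasurableFun.Build _ _ _ _ idR (@measurable_id _ _ setT).

Lemma PhiE : Phi = fine \o cdf (P := normal_prob 0 1) idR.
Proof. by []. Qed.

Lemma Phi_ge0 x : 0 <= Phi x.
Proof. by rewrite fine_ge0. Qed.

Lemma cvg_Phiy : Phi x @[x --> +oo] --> (1 : R).
Proof.
rewrite PhiE; apply: fine_cvg; exact: cvg_cdfy1.
Qed.

Lemma cvg_PhiNy : Phi x @[x --> -oo] --> (0 : R).
Proof.
rewrite PhiE; apply: fine_cvg; exact: cvg_cdfNy0.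
Qed.

(** [Phi x + Phi (- x)] has zero derivative and tends to one. *)
Lemma Phi_oppr x : Phi (- x) = 1 - Phi x.
Proof.
have d y : is_derive y (1 : R) (fun t => Phi t + Phi (- t)) 0.
  have d1 := is_derive_Phi y; have d2 := is_derive_Phi (- y).
  apply: is_derive_eq.
  by rewrite /GRing.scale /= phiN; lra.
have E y : Phi y + Phi (- y) = Phi x + Phi (- x).
  have [yx|xy] := leP y x.
    by have [c [_ _]] := mean_value d yx; lra.
  by have [c [_ _]] := mean_value d (ltW xy); lra.
suff : Phi x + Phi (- x) = 1 by lra.
have l1 : Phi y + Phi (- y) @[y --> +oo] --> 1 + (0 : R).
  apply: cvgD; first exact: cvg_Phiy.
  apply: (cvg_comp (fun x => - x) Phi); last exact: cvg_PhiNy.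
  exact/cvgNrNy/cvg_id.
have cE : (fun y => Phi y + Phi (- y)) = cst (Phi x + Phi (- x)) by apply/funext.
rewrite cE addr0 in l1.
exact: (cvg_unique (@Rhausdorff R) (cvg_cst _) l1).
Qed.

Lemma Phi_le1 x : Phi x <= 1.
Proof. by have := Phi_ge0 (- x); rewrite Phi_oppr; lra. Qed.

Lemma Phi0 : Phi 0 = 2^-1.
Proof. by have := Phi_oppr 0; rewrite oppr0; lra. Qed.

Lemma cvg_tail : 1 - Phi x @[x --> +oo] --> (0 : R).
Proof.
rewrite -(subrr (1 : R)).
by apply: cvgB; [exact: cvg_cst|exact: cvg_Phiy].
Qed.

Lemma mills_ge0 x : 0 <= mills x.
Proof. by rewrite divr_ge0 ?subr_ge0 ?Phi_le1 // ltW // phi_gt0. Qed.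

(** For fixed [x > 0], the map [t |-> phi t - x * (1 - Phi t)] decreases on
    [t >= x] and vanishes at infinity. *)
Lemma mills_upper x : x * mills x <= 1.
Proof.
have [x0|x0] := leP x 0.
  by rewrite (le_trans _ ler01) // mulr_le0_ge0 // mills_ge0.
rewrite mulrA ler_pdivrMr ?phi_gt0 // mul1r -subr_ge0.
apply: (@le0_derive_tail_ge0 _ (fun t => phi t - x * (1 - Phi t))
  (fun t => (x - t) * phi t)).
- move=> t; have d1 := is_derive_Phi t; have d2 := is_derive_phi t.
  apply: is_derive_eq.
  by rewrite /GRing.scale /=; lra.
- move=> t xt; rewrite mulr_le0_ge0 ?subr_le0 // ltW //; exact: phi_gt0.
rewrite -[X in _ --> X](subr0 (0:R)) -[X in _ --> _ - X](mulr0 x).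
apply: cvgB; first exact: cvg_phi.
by apply: cvgM; [exact: cvg_cst|exact: cvg_tail].
Qed.

(** Here [t |-> 1 - Phi t - t * phi t / (1 + t ^ 2)] decreases to zero.  This
    bound is exactly what makes [x * mills x] nondecreasing. *)
Lemma mills_lower x : x <= (1 + x ^+ 2) * mills x.
Proof.
have p0 (t : R) : 0 < 1 + t ^+ 2 by rewrite ltr_pwDl // sqr_ge0.
rewrite mulrA ler_pdivlMr ?phi_gt0 // mulrC [leRHS]mulrC -ler_pdivrMr // -subr_ge0.
apply: (@le0_derive_tail_ge0 _ (fun t => (1 - Phi t) - phi t * t / (1 + t ^+ 2))
  (fun t => - 2 * phi t / (1 + t ^+ 2) ^+ 2)).
- move=> t; have d1 := is_derive_Phi t; have d2 := is_derive_phi t.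
  have n0 : 1 + t ^+ 2 != 0 by rewrite gt_eqF.
  apply: is_derive_eq.
  rewrite /GRing.scale /=; field.
  exact: n0.
- move=> t xt; rewrite mulr_le0_ge0 ?invr_ge0 ?sqr_ge0 //.
  by rewrite mulNr oppr_le0 mulr_ge0 // ltW // phi_gt0.
rewrite -[X in _ --> X](subr0 (0:R)).
apply: cvgB; first exact: cvg_tail.
apply: (@squeeze_cvgr _ _ _ _ (fun t => - phi t) phi); last 2 first.
- by rewrite -oppr0; apply: cvgN; exact: cvg_phi.
- exact: cvg_phi.
near=> t; have p := phi_gt0 t.
rewrite ler_pdivlMr // ler_pdivrMr // mulNr -mulrN !ler_pM2l //.
by apply/andP; split; nra.
Unshelve. all: by end_near. Qed.

Lemma is_derive_mills x : is_derive x (1 : R) mills (x * mills x - 1).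
Proof.
have d1 := is_derive_Phi x; have d2 := is_derive_phi x.
have n0 : phi x != 0 by rewrite gt_eqF // phi_gt0.
rewrite /mills; apply: is_derive_eq.
by rewrite /GRing.scale /=; field.
Qed.

Lemma mills_nonincreasing x y : x <= y -> mills y <= mills x.
Proof.
move=> xy; have [c [_ _ E]] := mean_value is_derive_mills xy.
by rewrite -subr_le0 E mulr_le0_ge0 ?subr_ge0 // subr_le0 mills_upper.
Qed.

Lemma mills_le2 x : 0 <= x -> mills x <= 2.
Proof.
move=> /mills_nonincreasing/le_trans -> //.
rewrite /mills Phi0 ler_pdivrMr ?phi_gt0 //.
by have := phi0_ge; lra.
Qed.

Lemma mul_mills_nondecreasing x y : x <= y -> x * mills x <= y * mills y.
Proof.
have d t : is_derive t (1 : R) (fun t => t * mills t) ((1 + t ^+ 2) * mills t - t).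
  have d1 := is_derive_mills t.
  by apply: is_derive_eq; rewrite /GRing.scale /=; lra.
move=> xy; apply: ge0_derive_nondecr d _ xy => t _ _.
by rewrite subr_ge0 mills_lower.
Qed.

(** * The Stein equation

    [stein z] solves [f' w = w * f w + (w <= z) - Phi z]; both branches are
    multiples of a Mills ratio because [Phi w / phi w = mills (- w)]. *)
Definition stein z w : R :=
  if w <= z then mills (- w) * (1 - Phi z) else mills w * Phi z.

Lemma mills_opp z : mills (- z) * (1 - Phi z) = mills z * Phi z.
Proof.
by rewrite /mills phiN Phi_oppr; field; rewrite gt_eqF // phi_gt0.
Qed.

Lemma steinE z w : z <= w -> stein z w = mills w * Phi z.
Proof.
rewrite /stein le_eqVlt => /predU1P[<-|zw]; last by rewrite leNgt zw.
by rewrite lexx mills_opp.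
Qed.

Lemma stein_ge0 z w : 0 <= stein z w.
Proof.
by rewrite /stein; case: ifP => _; rewrite mulr_ge0 ?mills_ge0 ?Phi_ge0 // subr_ge0 Phi_le1.
Qed.

(** The maximum is at [w = z], where the value is a product of a Mills ratio at
    a nonnegative point and a probability. *)
Lemma stein_le2 z w : stein z w <= 2.
Proof.
have Qz : 0 <= 1 - Phi z by rewrite subr_ge0 Phi_le1.
suff zP : stein z z <= 2.
  apply: le_trans zP; have [wz|zw] := leP w z.
    by rewrite /stein wz lexx ler_wpM2r // mills_nonincreasing // lerN2.
  by rewrite !steinE ?(ltW zw) // ler_wpM2r ?Phi_ge0 // mills_nonincreasing // ltW.
have P1 := Phi_le1 z; have P0 := Phi_ge0 z.
have [z0|z0] := leP 0 z.
  rewrite steinE // -[leRHS]mulr1.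
  by apply: ler_pM; rewrite ?mills_ge0 // mills_le2.
rewrite /stein lexx -[leRHS]mulr1.
by apply: ler_pM; rewrite ?mills_ge0 ?mills_le2 //; lra.
Qed.

Lemma mul_stein_nondecreasing z x y : x <= y -> x * stein z x <= y * stein z y.
Proof.
have Qz : 0 <= 1 - Phi z by rewrite subr_ge0 Phi_le1.
have left_branch a b : a <= b -> b <= z -> a * stein z a <= b * stein z b.
  move=> ab bz; rewrite /stein bz (le_trans ab bz) -lerN2 -!mulNr.
  have ba : - b <= - a by rewrite lerN2.
  by have := ler_wpM2r Qz (mul_mills_nondecreasing ba); rewrite -!mulrA.
have right_branch a b : z <= a -> a <= b -> a * stein z a <= b * stein z b.
  move=> za ab; rewrite !steinE ?(le_trans za ab) // //.
  by have := ler_wpM2r (Phi_ge0 z) (mul_mills_nondecreasing ab); rewrite -!mulrA.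
move=> xy; have [yz|zy] := leP y z; first exact: left_branch.
have [zx|xz] := leP z x; first exact: right_branch.
exact: le_trans (left_branch x z (ltW xz) (lexx z)) (right_branch z y (lexx z) (ltW zy)).
Qed.

Lemma mul_stein_lower z w : w <= z -> - (1 - Phi z) <= w * stein z w.
Proof.
have Qz : 0 <= 1 - Phi z by rewrite subr_ge0 Phi_le1.
by move=> wz; rewrite /stein wz; have := mills_upper (- w); nra.
Qed.

Lemma mul_stein_upper z w : z <= w -> w * stein z w <= Phi z.
Proof.
by move=> zw; rewrite steinE //; have := mills_upper w; have := Phi_ge0 z; nra.
Qed.

(** The derivative of [stein z], read off from the Stein equation, with its left
    value at [z]. *)
Definition dstein z w : R := w * stein z w - (z < w)%R%:R + (1 - Phi z).

Lemma mul_stein_le1 z w : `|w * stein z w| <= 1.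
Proof.
have P1 := Phi_le1 z; have P0 := Phi_ge0 z.
rewrite ler_norml; have [wz|zw] := leP w z.
  have := mul_stein_lower wz; have := mul_stein_nondecreasing z wz.
  by have := mul_stein_upper (lexx z); lra.
have := mul_stein_upper (ltW zw); have := mul_stein_nondecreasing z (ltW zw).
by have := mul_stein_lower (lexx z); lra.
Qed.

Lemma dstein_le1 z w : `|dstein z w| <= 1.
Proof.
have P1 := Phi_le1 z; have P0 := Phi_ge0 z.
rewrite /dstein ler_norml; have [wz|zw] := leP w z; rewrite ?mulr0n ?mulr1n.
  have := mul_stein_lower wz; have := mul_stein_nondecreasing z wz.
  by have := mul_stein_upper (lexx z); lra.
have := mul_stein_upper (ltW zw); have := mul_stein_nondecreasing z (ltW zw).
by have := mul_stein_lower (lexx z); lra.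
Qed.

(** The derivative of [stein z] is the difference of the two nondecreasing
    functions [w * stein z w] and [z < w], up to a constant.  Hence an increment
    over [[a, b]] is bracketed by end point values, in spite of the jump at
    [z]. *)
Lemma stein_increment z a b : a < b ->
  (b - a) * (a * stein z a - (z < b)%R%:R + (1 - Phi z)) <= stein z b - stein z a
  <= (b - a) * (b * stein z b - (z < a)%R%:R + (1 - Phi z)).
Proof.
have P1 := Phi_le1 z; have P0 := Phi_ge0 z.
have left_branch x y : x <= y -> y <= z ->
  (y - x) * (x * stein z x + (1 - Phi z)) <= stein z y - stein z x <=
  (y - x) * (y * stein z y + (1 - Phi z)).
  move=> xy yz.
  have d t : is_derive t (1 : R) (fun t => mills (- t) * (1 - Phi z))
    (t * (mills (- t) * (1 - Phi z)) + (1 - Phi z)).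
    have d1 := is_derive_mills (- t).
    by apply: is_derive_eq; rewrite /GRing.scale /=; lra.
  have [c [xc cy E]] := mean_value d xy.
  have F t : t <= z -> mills (- t) * (1 - Phi z) = stein z t by rewrite /stein => ->.
  move: E; rewrite !F ?(le_trans xy) ?(le_trans cy) // => ->.
  have := mul_stein_nondecreasing z xc; have := mul_stein_nondecreasing z cy.
  by move=> ? ?; rewrite -!(mulrC (y - x)) !ler_wpM2l ?subr_ge0 ?lerD2r.
have right_branch x y : x <= y -> z <= x ->
  (y - x) * (x * stein z x - Phi z) <= stein z y - stein z x <=
  (y - x) * (y * stein z y - Phi z).
  move=> xy zx.
  have d t : is_derive t (1 : R) (fun t => mills t * Phi z)
    (t * (mills t * Phi z) - Phi z).
    have d1 := is_derive_mills t.
    by apply: is_derive_eq; rewrite /GRing.scale /=; lra.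
  have [c [xc cy E]] := mean_value d xy.
  have F t : z <= t -> mills t * Phi z = stein z t by move=> /steinE ->.
  move: E; rewrite !F ?(le_trans zx) // => ->.
  have := mul_stein_nondecreasing z xc; have := mul_stein_nondecreasing z cy.
  by move=> ? ?; rewrite -!(mulrC (y - x)) !ler_wpM2l ?subr_ge0 ?lerD2r.
move=> ab; have [bz|zb] := leP b z.
  have := left_branch a b (ltW ab) bz.
  by rewrite (ltNge z a) (le_trans (ltW ab) bz) /= !mulr0n !subr0.
have [za|az] := ltP z a.
  by have := right_branch a b (ltW ab) (ltW za); rewrite !mulr1n; lra.
have := left_branch a z az (lexx z); have := right_branch z b (ltW zb) (lexx z).
have := mul_stein_nondecreasing z az; have := mul_stein_nondecreasing z (ltW zb).
move: (a * stein z a) (b * stein z b) (z * stein z z) => ga gb gz.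
move: (stein z a) (stein z b) (stein z z) => fa fb fz h1 h2 /andP[h3 h4] /andP[h5 h6].
rewrite mulr0n mulr1n.
have bz0 : 0 <= b - z by rewrite subr_ge0 ltW.
have za0 : 0 <= z - a by rewrite subr_ge0.
have h7 := ler_wpM2l bz0 h1; have h8 := ler_wpM2l za0 h1.
have h9 := ler_wpM2l bz0 h2; have h10 := ler_wpM2l za0 h2.
by apply/andP; split; lra.
Qed.

End gaussian.

(** * Averages over a finite type *)
Section averages.
Context {R : realType} {A : finType}.
Implicit Types f g : A -> R.

Definition avg f : R := (\sum_a f a) / #|A|%:R.

Lemma eq_avg f g : f =1 g -> avg f = avg g.
Proof. by move=> fg; rewrite /avg (eq_bigr g). Qed.

Lemma avgD f g : avg (fun a => f a + g a) = avg f + avg g.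
Proof. by rewrite /avg big_split mulrDl. Qed.

Lemma avgN f : avg (fun a => - f a) = - avg f.
Proof. by rewrite /avg sumrN mulNr. Qed.

Lemma avgB f g : avg (fun a => f a - g a) = avg f - avg g.
Proof. by rewrite avgD avgN. Qed.

Lemma avgZ c f : avg (fun a => c * f a) = c * avg f.
Proof. by rewrite /avg -mulr_sumr mulrA. Qed.

Lemma avgZr c f : avg (fun a => f a * c) = avg f * c.
Proof. by rewrite mulrC -avgZ; apply: eq_avg => a; rewrite mulrC. Qed.

Lemma avg_sum (J : Type) (s : seq J) (P : pred J) (F : J -> A -> R) :
  avg (fun a => \sum_(j <- s | P j) F j a) = \sum_(j <- s | P j) avg (F j).
Proof. by rewrite /avg exchange_big /= mulr_suml. Qed.

Lemma ler_avg f g : (forall a, f a <= g a) -> avg f <= avg g.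
Proof. by move=> fg; rewrite ler_wpM2r ?invr_ge0 // ler_sum. Qed.

Lemma avg_ge0 f : (forall a, 0 <= f a) -> 0 <= avg f.
Proof. by move=> f0; rewrite mulr_ge0 ?invr_ge0 // sumr_ge0. Qed.

Lemma ler_norm_avg f : `|avg f| <= avg (fun a => `|f a|).
Proof.
rewrite normrM [`|_^-1|]ger0_norm ?invr_ge0 // ler_wpM2r ?invr_ge0 //.
exact: ler_norm_sum.
Qed.

(** The quadratic form [avg ((f - t * g) ^ 2)] is nonnegative; evaluate it at
    its minimiser [t = p / G]. *)
Lemma avg_cauchy_schwarz f g :
  avg (fun a => f a * g a) ^+ 2 <= avg (fun a => f a ^+ 2) * avg (fun a => g a ^+ 2).
Proof.
set p := avg (fun a => f a * g a); set F := avg _; set G := avg _.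
have G0 : 0 <= G by apply: avg_ge0 => a; rewrite sqr_ge0.
have quad t : 0 <= F - 2 * t * p + t ^+ 2 * G.
  rewrite -avgZ -avgB -avgZ -avgD; apply: avg_ge0 => a.
  rewrite (_ : _ + _ = (f a - t * g a) ^+ 2) ?sqr_ge0 //; ring.
have [G_eq0|Gn0] := eqVneq G 0.
  have p0 : p = 0.
    (* If [g] is null, [quad] is affine in [t]; this [t] makes it negative. *)
    apply/eqP; apply: contraT => pn0; have := quad ((F + 1) / (2 * p)).
    rewrite G_eq0 mulr0 addr0 (_ : 2 * _ * p = F + 1); [lra|by field].
  by rewrite p0 expr0n /= mulr_ge0 // avg_ge0 // => a; rewrite sqr_ge0.
have Gp : 0 < G by rewrite lt_def Gn0.
have := quad (p / G).
rewrite (_ : _ + _ = F - p ^+ 2 / G); last by field.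
by rewrite subr_ge0 ler_pdivrMr.
Qed.

Context (A_gt0 : (0 < #|A|)%N).

Lemma avg_cst c : avg (fun=> c) = c.
Proof.
by rewrite /avg sumr_const -[c *+ _]mulr_natr mulfK // pnatr_eq0 -lt0n.
Qed.

Lemma avg_le f c : (forall a, f a <= c) -> avg f <= c.
Proof. by move=> fc; rewrite -[leRHS]avg_cst ler_avg. Qed.

Lemma avg_norm_le f c : (forall a, `|f a| <= c) -> `|avg f| <= c.
Proof. by move=> fc; apply: le_trans (ler_norm_avg f) (avg_le fc). Qed.

Lemma avg_sqr_le f : avg f ^+ 2 <= avg (fun a => f a ^+ 2).
Proof.
have := avg_cauchy_schwarz f (fun=> 1).
rewrite (eq_avg (g := f)) ?(eq_avg (f := fun=> 1 ^+ 2) (g := fun=> 1)) ?avg_cst ?mulr1 //.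
- by move=> a; rewrite expr1n.
- by move=> a; rewrite mulr1.
Qed.

Lemma avg_norm_le_sqrt f c : 0 <= c -> avg (fun a => f a ^+ 2) <= c ^+ 2 ->
  avg (fun a => `|f a|) <= c.
Proof.
move=> c0 fc; rewrite -(@ler_pXn2r _ 2) ?nnegrE ?avg_ge0 //.
apply: le_trans (avg_sqr_le _) _; apply: le_trans fc.
by apply: ler_avg => a; rewrite real_normK ?num_real.
Qed.

End averages.

Lemma exchange_avg (R : realType) (A B : finType) (F : A -> B -> R) :
  avg (fun a => avg (F a)) = avg (fun b => avg (F^~ b)).
Proof. by rewrite /avg -!mulr_suml exchange_big /= mulrAC. Qed.

(** * Resampling a coordinate *)
Section product_space.
Context {R : realType} {I T : finType}.
Context (T_gt0 : (0 < #|T|)%N).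
Local Notation Omega := {ffun I -> T}.
Implicit Types (f g : Omega -> R) (u : Omega) (v w : I) (t : T).

Definition upd u v t : Omega := [ffun i => if i == v then t else u i].

Lemma upd_id u v : upd u v (u v) = u.
Proof. by apply/ffunP => i; rewrite ffunE; case: eqP => [->|]. Qed.

Lemma upd_upd u v t t' : upd (upd u v t) v t' = upd u v t'.
Proof. by apply/ffunP => i; rewrite !ffunE; case: eqP. Qed.

Lemma upd_same u v t : upd u v t v = t.
Proof. by rewrite ffunE eqxx. Qed.

Lemma upd_neq u v t w : w != v -> upd u v t w = u w.
Proof. by rewrite ffunE => /negPf ->. Qed.

Lemma updC u v w t t' : v != w -> upd (upd u v t) w t' = upd (upd u w t') v t.
Proof.
move=> vw; apply/ffunP => i; rewrite !ffunE.
by case: eqP => // ->; case: eqP => // wv; rewrite wv eqxx in vw.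
Qed.

Lemma Omega_gt0 : (0 < #|{: Omega}|)%N.
Proof. by rewrite card_ffun expn_gt0 T_gt0. Qed.

(** Exchangeability: [u] and [u] with a fresh coordinate [v] have the same joint
    law in both orders.  Every symmetry used later comes from here. *)
Lemma avg_swap v (F : Omega -> Omega -> R) :
  avg (fun u => avg (fun t => F u (upd u v t))) =
  avg (fun u => avg (fun t => F (upd u v t) u)).
Proof.
rewrite /avg -!mulr_suml; congr (_ / _ / _).
rewrite !pair_big /=.
rewrite (reindex_inj (h := fun p : Omega * T => (upd p.1 v p.2, p.1 v))).
  by apply: eq_bigr => -[u t] _ /=; rewrite upd_upd upd_id.
move=> [u t] [u' t'] /= [uu tt]; congr pair.
  by rewrite -(upd_id u v) -(upd_id u' v) -(upd_upd u v t) -(upd_upd u' v t') uu tt.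
by rewrite -(upd_same u v t) uu upd_same.
Qed.

(** [resample v] is the conditional expectation given all coordinates but [v]:
    these operators are commuting orthogonal projections. *)
Definition resample v f u : R := avg (fun t => f (upd u v t)).
Definition residual v f u : R := f u - resample v f u.

(** [f] does not depend on coordinate [v]. *)
Definition invariant_at v f := forall u t, f (upd u v t) = f u.

Lemma resample_invariant v f : invariant_at v (resample v f).
Proof. by move=> u t; apply: eq_avg => t'; rewrite upd_upd. Qed.

Lemma resample_id v f : invariant_at v f -> resample v f = f.
Proof.
move=> fv; apply/funext => u; rewrite /resample (eq_avg (g := fun=> f u)) ?avg_cst //.
Qed.

Lemma avg_resample v f : avg (resample v f) = avg f.
Proof.
rewrite /resample (avg_swap v (fun _ x => f x)) /=.
by apply: eq_avg => u; rewrite avg_cst.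
Qed.

Lemma resample_adj v f g :
  avg (fun u => f u * resample v g u) = avg (fun u => resample v f u * g u).
Proof.
have E1 : avg (fun u => f u * resample v g u) =
  avg (fun u => avg (fun t => f u * g (upd u v t))).
  by apply: eq_avg => u; rewrite avgZ.
have E2 : avg (fun u => resample v f u * g u) =
  avg (fun u => avg (fun t => f (upd u v t) * g u)).
  by apply: eq_avg => u; rewrite avgZr.
by rewrite E1 E2 (avg_swap v (fun x y => f x * g y)).
Qed.

Lemma resampleC v w f : resample v (resample w f) = resample w (resample v f).
Proof.
have [->//|vw] := eqVneq v w.
apply/funext => u; rewrite /resample exchange_avg.
by apply: eq_avg => t; apply: eq_avg => t'; rewrite updC.
Qed.

Lemma resampleD v f g :
  resample v (fun u => f u + g u) = fun u => resample v f u + resample v g u.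
Proof. by apply/funext => u; rewrite /resample avgD. Qed.

Lemma resampleZ v c f : resample v (fun u => c * f u) = fun u => c * resample v f u.
Proof. by apply/funext => u; rewrite /resample avgZ. Qed.

Lemma resample_sum v (J : Type) (s : seq J) (P : pred J) (F : J -> Omega -> R) :
  resample v (fun u => \sum_(j <- s | P j) F j u) =
  fun u => \sum_(j <- s | P j) resample v (F j) u.
Proof. by apply/funext => u; rewrite /resample avg_sum. Qed.

Lemma residualD v f g :
  residual v (fun u => f u + g u) = fun u => residual v f u + residual v g u.
Proof. by apply/funext => u; rewrite /residual resampleD opprD addrACA. Qed.

Lemma residualZ v c f : residual v (fun u => c * f u) = fun u => c * residual v f u.
Proof. by apply/funext => u; rewrite /residual resampleZ mulrBr. Qed.

Lemma residual_sum v (J : Type) (s : seq J) (P : pred J) (F : J -> Omega -> R) :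
  residual v (fun u => \sum_(j <- s | P j) F j u) =
  fun u => \sum_(j <- s | P j) residual v (F j) u.
Proof. by apply/funext => u; rewrite /residual resample_sum -sumrB. Qed.

Lemma residual_invariant v f : invariant_at v f -> residual v f = fun=> 0.
Proof. by move=> fv; apply/funext => u; rewrite /residual resample_id // subrr. Qed.

Lemma resample_residual v w f :
  resample v (residual w f) = residual w (resample v f).
Proof.
have -> : residual w f = fun u => f u + -1 * resample w f u.
  by apply/funext => u; rewrite mulN1r.
by rewrite resampleD resampleZ resampleC; apply/funext => u; rewrite mulN1r.
Qed.

Lemma resample_residual0 v f : resample v (residual v f) = fun=> 0.
Proof. by rewrite resample_residual residual_invariant //; exact: resample_invariant. Qed.

Lemma residualC v w f : residual v (residual w f) = residual w (residual v f).
Proof.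
apply/funext => u; rewrite {1 3}/residual !resample_residual /residual resampleC.
by rewrite !opprB addrACA [in RHS]addrACA; congr (_ + _); rewrite addrC.
Qed.

Lemma residual_idem v f : residual v (residual v f) = residual v f.
Proof. by apply/funext => u; rewrite {1}/residual resample_residual0 subr0. Qed.

Definition msq f : R := avg (fun u => f u ^+ 2).

Lemma msq_ge0 f : 0 <= msq f.
Proof. by apply: avg_ge0 => u; rewrite sqr_ge0. Qed.

Lemma msq_pythagoras v f : msq f = msq (resample v f) + msq (residual v f).
Proof.
rewrite /msq -avgD.
have E : avg (fun u => f u * resample v f u) = avg (fun u => resample v f u ^+ 2).
  rewrite -{1}(resample_id (resample_invariant v f)) resample_adj.
  by apply: eq_avg => u; rewrite expr2.
have -> : avg (fun u => f u ^+ 2) = avg (fun u => f u ^+ 2) +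
  2 * (avg (fun u => resample v f u ^+ 2) - avg (fun u => f u * resample v f u)).
  by rewrite E subrr mulr0 addr0.
rewrite -avgB -avgZ -avgD; apply: eq_avg => u.
by rewrite /residual; ring.
Qed.

Lemma msq_resample v f : msq (resample v f) <= msq f.
Proof. by rewrite (msq_pythagoras v f) lerDl msq_ge0. Qed.

Lemma msq_residual v f : msq (residual v f) <= msq f.
Proof. by rewrite (msq_pythagoras v f) lerDr msq_ge0. Qed.

Definition resamples (s : seq I) f := foldr resample f s.

Lemma resamples_residual s v f : resamples s (residual v f) = residual v (resamples s f).
Proof. by elim: s => //= w s ->; rewrite resample_residual. Qed.

Lemma resamples_sum s (J : Type) (r : seq J) (P : pred J) (F : J -> Omega -> R) :
  resamples s (fun u => \sum_(j <- r | P j) F j u) =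
  fun u => \sum_(j <- r | P j) resamples s (F j) u.
Proof. by elim: s => //= w s ->; rewrite resample_sum. Qed.

Lemma resamples_invariant s f v : v \in s -> invariant_at v (resamples s f).
Proof.
elim: s => //= w s IH; rewrite inE => /orP[/eqP->|/IH vs]; first exact: resample_invariant.
move=> u t; rewrite -(resample_id vs) resampleC; exact: resample_invariant.
Qed.

Lemma resamples_residual0 s v f : v \in s -> resamples s (residual v f) = fun=> 0.
Proof.
by move=> vs; rewrite resamples_residual residual_invariant //; exact: resamples_invariant.
Qed.

Lemma avg_resamples s f : avg (resamples s f) = avg f.
Proof. by elim: s => //= v s IH; rewrite avg_resample. Qed.

Lemma msq_resamples s f : msq (resamples s f) <= msq f.
Proof. by elim: s => //= v s; apply: le_trans; exact: msq_resample. Qed.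

(** Each projection applied removes from the mean square the mean square of a
    residual of the function already averaged; projections being contractions
    that commute with residuals, this is at most the residual of [f] itself. *)
Lemma efron_stein_seq s f :
  msq f <= msq (resamples s f) + \sum_(v <- s) msq (residual v f).
Proof.
elim: s => [|v s IH] /=; first by rewrite big_nil addr0.
apply: le_trans IH _; rewrite big_cons addrA lerD2r.
rewrite (msq_pythagoras v (resamples s f)) lerD2l -resamples_residual.
exact: msq_resamples.
Qed.

Lemma invariant_agree (P : pred I) f : (forall v, P v -> invariant_at v f) ->
  forall u u', (forall v, ~~ P v -> u v = u' v) -> f u = f u'.
Proof.
move=> fP u u' uu'.
suff E (s : seq I) : {subset s <= P} -> f [ffun i => if i \in s then u' i else u i] = f u.
  rewrite -(E (enum P)); last by move=> v; rewrite mem_enum.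
  congr f; apply/ffunP => i; rewrite ffunE mem_enum; case: ifPn => //; exact: uu'.
elim: s => [|v s IH] sP; first by congr f; apply/ffunP => i; rewrite ffunE.
rewrite -IH; last by move=> x xs; apply: sP; rewrite inE xs orbT.
have Pv : P v by apply: sP; rewrite inE eqxx.
rewrite -[RHS](fP v Pv _ (u' v)); congr f; apply/ffunP => i; rewrite !ffunE inE.
by case: eqP => [->|].
Qed.

Lemma resamples_all f : resamples (enum I) f = fun=> avg f.
Proof.
apply/funext => u; rewrite -(avg_resamples (enum I) f).
rewrite -(avg_cst Omega_gt0 (resamples (enum I) f u)); apply: eq_avg => u'.
by apply: (@invariant_agree predT) => // v _; apply: resamples_invariant; rewrite mem_enum.
Qed.

(** The Efron-Stein inequality: averaging over all coordinates leaves the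
    mean. *)
Lemma efron_stein f : msq (fun u => f u - avg f) <= \sum_v msq (residual v f).
Proof.
have := efron_stein_seq (enum I) (fun u => f u - avg f).
rewrite resamples_all avgB avg_cst ?Omega_gt0 // subrr {2}/msq.
rewrite avg_cst ?Omega_gt0 // expr0n /= add0r big_enum /=.
move=> /le_trans; apply; apply: ler_sum => v _; rewrite le_eqVlt; apply/orP; left.
apply/eqP; congr msq.
by apply/funext => u; rewrite /residual /resample avgB avg_cst //; ring.
Qed.

Lemma ler_msq f c : (forall u, `|f u| <= c) -> msq f <= c ^+ 2.
Proof.
move=> fc; rewrite -[leRHS](avg_cst Omega_gt0); apply: ler_avg => u.
by rewrite -real_normK ?num_real // lerXn2r ?nnegrE // (le_trans _ (fc u)).
Qed.

(** * Normal approximation by exchangeable pairs *)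

(** Summed over the coordinate resampled, the conditional expectation of
    [psi (W - W')] given [u]. *)
Definition jump_stat (psi : R -> R) (W : Omega -> R) u : R :=
  \sum_v avg (fun t => psi (W u - W (upd u v t))).

(** The factor two is the eigenvalue of [\sum_v residual v] on functions of two
    coordinates, where the crossing number has its main part. *)
Definition regression_error (W : Omega -> R) u : R :=
  (\sum_v residual v W u) / 2 - W u.

Lemma avg_antisym v (F : Omega -> Omega -> R) : (forall x y, F x y = - F y x) ->
  avg (fun u => avg (fun t => F u (upd u v t))) = 0.
Proof.
move=> FN; suff: avg (fun u => avg (fun t => F u (upd u v t))) =
    - avg (fun u => avg (fun t => F u (upd u v t))) by lra.
rewrite {1}avg_swap -avgN; apply: eq_avg => u; rewrite -avgN.
by apply: eq_avg => t; rewrite FN.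
Qed.

(** Adding the antisymmetric quantity [psi (W - W') * (f W + f W')], which has
    mean zero, doubles [f W] and removes [f W']. *)
Lemma avg_jump_mul (psi f : R -> R) (W : Omega -> R) :
  (forall x, psi (- x) = - psi x) ->
  \sum_v avg (fun u => avg (fun t =>
     psi (W u - W (upd u v t)) * (f (W u) - f (W (upd u v t))))) =
  2 * avg (fun u => jump_stat psi W u * f (W u)).
Proof.
move=> psiN; rewrite /jump_stat.
under [in RHS]eq_avg do rewrite mulr_suml.
rewrite avg_sum mulr_sumr; apply: eq_bigr => v _.
rewrite -avgZ.
rewrite -[LHS]subr0 -[X in _ - X](avg_antisym v (F := fun x y =>
   - (psi (W x - W y) * (f (W x) + f (W y))))); last first.
  by move=> x y; rewrite -(opprB (W y)) psiN; ring.
rewrite -avgB; apply: eq_avg => u; rewrite -avgB -avgZr -avgZ.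
by apply: eq_avg => t; ring.
Qed.

Lemma jump_stat_id W u : jump_stat id W u = \sum_v residual v W u.
Proof.
by apply: eq_bigr => v _; rewrite /residual /resample avgB avg_cst.
Qed.

Lemma avg_regression (f : R -> R) (W : Omega -> R) :
  avg (fun u => W u * f (W u)) =
  4^-1 * (\sum_v avg (fun u => avg (fun t =>
     (W u - W (upd u v t)) * (f (W u) - f (W (upd u v t)))))) -
  avg (fun u => regression_error W u * f (W u)).
Proof.
rewrite (@avg_jump_mul id) // mulrA -avgZ -avgB; apply: eq_avg => u.
by rewrite jump_stat_id /regression_error; lra.
Qed.

Section stein_method.
Variable W : Omega -> R.
Hypothesis msqW : msq W = 1.

Local Notation B := (jump_stat (fun x => x ^+ 2) W).
Local Notation C := (jump_stat (fun x => x * `|x|) W).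
Local Notation E := (regression_error W).

Definition jump (z x : R) : R := (z < x)%R%:R.

(** One resampling step, [w] to [w']: the linearisation error of [stein z] is
    squeezed between [delta |delta|] times increments of nondecreasing
    functions, up to a term [delta ^ 2 * (A w - A w')] that is antisymmetric in
    [w], [w'] and so will vanish on average. *)
Lemma stein_jump (z w w' : R) :
  `|(w - w') * (stein z w - stein z w') - (w - w') ^+ 2 * dstein z w
    - (w - w') ^+ 2 / 2 *
      ((jump z w - w * stein z w) - (jump z w' - w' * stein z w'))|
  <= (w - w') * `|w - w'| / 2 *
      ((jump z w + w * stein z w) - (jump z w' + w' * stein z w')).
Proof.
rewrite /dstein -/(jump z w) ler_norml.
move: (stein_increment z (a := w') (b := w)) (stein_increment z (a := w) (b := w')).
rewrite -/(jump z w) -/(jump z w').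
set J := jump z; set g := fun x => x * stein z x; rewrite -/(g w) -/(g w').
set d := w - w' => inc1 inc2.
case: (ltgtP w' w) => [ww|ww|ww].
- have d0 : 0 < d by rewrite subr_gt0.
  have /andP[] := inc1 ww; rewrite -/d.
  move=> /(ler_wpM2l (ltW d0)) h1 /(ler_wpM2l (ltW d0)) h2.
  by rewrite (gtr0_norm d0); apply/andP; split; lra.
- have d0 : d < 0 by rewrite subr_lt0.
  have /andP[] := inc2 ww; rewrite -(opprB w) -/d.
  move=> /(ler_wnM2l (ltW d0)) h1 /(ler_wnM2l (ltW d0)) h2.
  by rewrite (ltr0_norm d0); apply/andP; split; lra.
by rewrite /d ww subrr expr0n /= !mul0r subrr sub0r oppr0 lexx.
Qed.

(** Insert the Stein equation in [avg_regression].  What remains is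
    [dstein * (1 - B / 4)], the regression error against [stein <= 2], and the
    linearisation errors of [stein_jump]; averaging the latter by
    exchangeability moves all the weight on [C] against functions bounded by
    two. *)
Lemma stein_bound_L1 z :
  `|avg (fun u => (W u <= z)%R%:R) - Phi z| <=
  avg (fun u => `|1 - B u / 4|) + 2 * avg (fun u => `|E u|)
  + 2^-1 * avg (fun u => `|C u|).
Proof.
pose J := jump z; pose g x := x * stein z x.
have card1 := Omega_gt0.
pose TT u v t := (W u - W (upd u v t)) * (stein z (W u) - stein z (W (upd u v t)))
  - (W u - W (upd u v t)) ^+ 2 * dstein z (W u).
have decomp : avg (fun u => (W u <= z)%R%:R) - Phi z =
    avg (fun u => dstein z (W u) * (1 - B u / 4)) + avg (fun u => E u * stein z (W u))
    - 4^-1 * \sum_v avg (fun u => avg (TT u v)).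
  have -> : \sum_v avg (fun u => avg (TT u v)) =
     \sum_v avg (fun u => avg (fun t =>
       (W u - W (upd u v t)) * (stein z (W u) - stein z (W (upd u v t)))))
     - avg (fun u => B u * dstein z (W u)).
    have -> : avg (fun u => B u * dstein z (W u)) = \sum_v avg (fun u =>
        avg (fun t => (W u - W (upd u v t)) ^+ 2) * dstein z (W u)).
      by rewrite -avg_sum; apply: eq_avg => u; rewrite mulr_suml.
    rewrite -sumrB; apply: eq_bigr => v _; rewrite -avgB; apply: eq_avg => u.
    by rewrite -avgZr -avgB.
  rewrite mulrBr.
  have := avg_regression (stein z) W.
  set S := 4^-1 * \sum_v _ => SE.
  have -> : S = avg (fun u => W u * stein z (W u)) + avg (fun u => E u * stein z (W u)).
    by rewrite SE; ring.
  have : avg (fun u => (W u <= z)%R%:R - Phi z) =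
      avg (fun u => dstein z (W u) * (1 - B u / 4) - W u * stein z (W u)
        + 4^-1 * (B u * dstein z (W u))).
    apply: eq_avg => u.
    by rewrite /dstein ltNge; case: (W u <= z); rewrite /= ?mulr0n ?mulr1n; lra.
  by rewrite avgB (avg_cst card1) avgD avgB avgZ; lra.
have TTle : `|\sum_v avg (fun u => avg (TT u v))| <= 2 * avg (fun u => `|C u|).
  have A0 v : avg (fun u => avg (fun t => (W u - W (upd u v t)) ^+ 2 / 2 *
      ((J (W u) - g (W u)) - (J (W (upd u v t)) - g (W (upd u v t)))))) = 0.
    apply: (avg_antisym v (F := fun x y => (W x - W y) ^+ 2 / 2 *
      ((J (W x) - g (W x)) - (J (W y) - g (W y))))) => x y.
    by rewrite -(opprB (W y)) sqrrN -(opprB (_ y)) -?mulrN; ring.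
  apply: (@le_trans _ _ (2^-1 * \sum_v avg (fun u => avg (fun t =>
     (W u - W (upd u v t)) * `|W u - W (upd u v t)| *
     ((J (W u) + g (W u)) - (J (W (upd u v t)) + g (W (upd u v t)))))))).
    rewrite mulr_sumr; apply: le_trans (ler_norm_sum _ _ _) _.
    apply: ler_sum => v _; rewrite -[X in `|X|]subr0 -[X in `|_ - X|](A0 v).
    rewrite -avgB -avgZ; apply: le_trans (ler_norm_avg _) _; apply: ler_avg => u.
    rewrite -avgB -avgZ; apply: le_trans (ler_norm_avg _) _; apply: ler_avg => t.
    apply: le_trans (stein_jump z (W u) (W (upd u v t))) _.
    by rewrite [leRHS]mulrA [2^-1 * _]mulrC.
  rewrite (avg_jump_mul (psi := fun x => x * `|x|) (fun x => J x + g x)); last first.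
    by move=> x; rewrite normrN mulNr.
  rewrite mulrA mulVf ?mul1r ?pnatr_eq0 // -avgZ; apply: ler_avg => u.
  apply: le_trans (ler_norm _) _; rewrite normrM mulrC ler_wpM2r //.
  apply: le_trans (ler_normD _ _) _; have := mul_stein_le1 z (W u).
  have : `|J (W u)| <= 1 by rewrite /J /jump; case: (_ < _); rewrite ?normr1 ?normr0.
  by rewrite /g; lra.
rewrite decomp.
apply: le_trans (ler_normB _ _) _; apply: lerD; last first.
  by rewrite normrM gtr0_norm ?invr_gt0 //; lra.
apply: le_trans (ler_normD _ _) _; apply: lerD.
  apply: le_trans (ler_norm_avg _) _; apply: ler_avg => u.
  by rewrite normrM ler_piMl // dstein_le1.
rewrite -avgZ; apply: le_trans (ler_norm_avg _) _; apply: ler_avg => u.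
by rewrite normrM mulrC ler_wpM2r // ger0_norm ?stein_ge0 ?stein_le2.
Qed.

(** Taking the identity for the test function in [avg_regression] shows that the
    mean of [B] is close to four. *)
Lemma avg_jump_sqr : `|1 - avg B / 4| <= avg (fun u => `|E u * W u|).
Proof.
have E1 := avg_regression id W.
have B1 : avg (fun u => W u * id (W u)) = 1 by rewrite -msqW; apply: eq_avg => u; rewrite expr2.
have B2 : \sum_v avg (fun u => avg (fun t => (W u - W (upd u v t)) *
  (id (W u) - id (W (upd u v t))))) = avg B.
  rewrite avg_sum; apply: eq_bigr => v _; apply: eq_avg => u; apply: eq_avg => t.
  by rewrite expr2.
rewrite B1 B2 in E1.
rewrite (_ : 1 - _ = - avg (fun u => E u * W u)); last by rewrite {1}E1; lra.
by rewrite normrN ler_norm_avg.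
Qed.

Theorem stein_bound z (b c r : R) : 0 <= b -> 0 <= c -> 0 <= r ->
  msq (fun u => B u - avg B) <= b ^+ 2 -> msq C <= c ^+ 2 -> msq E <= r ^+ 2 ->
  `|avg (fun u => (W u <= z)%R%:R) - Phi z| <= b / 4 + 3 * r + c / 2.
Proof.
move=> b0 c0 r0 Bb Cc Er; apply: le_trans (stein_bound_L1 z) _.
have h1 := avg_norm_le_sqrt Omega_gt0 c0 Cc.
have h2 := avg_norm_le_sqrt Omega_gt0 r0 Er.
have h3 := avg_norm_le_sqrt Omega_gt0 b0 Bb.
have h4 : avg (fun u => `|E u * W u|) <= r.
  rewrite -(@ler_pXn2r _ 2) ?nnegrE ?avg_ge0 //.
  apply: le_trans Er; rewrite -[leRHS]mulr1 -msqW.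
  have -> : avg (fun u => `|E u * W u|) = avg (fun u => `|E u| * `|W u|).
    by apply: eq_avg => u; rewrite normrM.
  apply: le_trans (avg_cauchy_schwarz _ _) _.
  by rewrite le_eqVlt; apply/orP; left; apply/eqP; congr (_ * _); apply: eq_avg => u;
    rewrite real_normK ?num_real.
have h5 : avg (fun u => `|1 - B u / 4|) <= `|1 - avg B / 4| + avg (fun u => `|B u - avg B|) / 4.
  set m := avg B; rewrite -(avg_cst Omega_gt0 `|1 - m / 4|) -avgZr -avgD.
  apply: ler_avg => u.
  rewrite -[X in _ + _ / X]gtr0_norm // -normf_div.
  apply: le_trans (ler_normB _ _); rewrite le_eqVlt; apply/orP; left; apply/eqP.
  by congr `|_|; lra.
by have := avg_jump_sqr; lra.
Qed.

End stein_method.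
(** * Efron-Stein bounds for the error terms *)
Lemma jump_stat_scale (psi : R -> R) (c k : R) (X : Omega -> R) a :
  (forall x, psi (c * x) = k * psi x) ->
  jump_stat psi (fun u => c * (X u - a)) = fun u => k * jump_stat psi X u.
Proof.
move=> psic; apply/funext => u; rewrite /jump_stat mulr_sumr.
apply: eq_bigr => v _; rewrite -avgZ; apply: eq_avg => t.
by rewrite -psic; congr psi; ring.
Qed.

(** Moving coordinate [w] changes the summand of coordinate [v] through a second
    difference of [X], and that of [w] itself through first differences. *)
Lemma jump_stat_variance (psi : R -> R) (X : Omega -> R) (M : I -> R) (K : I -> I -> R)
  (psi_lip : forall L x y : R, `|x| <= L -> `|y| <= L -> `|psi x - psi y| <= 2 * L * `|x - y|)
  (XM : forall u v t, `|X u - X (upd u v t)| <= M v)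
  (XK : forall u v w t s, v != w ->
     `|X u - X (upd u v t) - (X (upd u w s) - X (upd (upd u w s) v t))| <= K v w) :
  msq (fun u => jump_stat psi X u - avg (jump_stat psi X)) <=
  \sum_w (\sum_(v | v != w) 2 * M v * K v w + 2 * M w ^+ 2) ^+ 2.
Proof.
apply: le_trans (efron_stein _) _; apply: ler_sum => w _.
apply: ler_msq => u.
have -> : residual w (jump_stat psi X) u =
    avg (fun s => jump_stat psi X u - jump_stat psi X (upd u w s)).
  by rewrite /residual /resample avgB avg_cst.
apply: avg_norm_le => // s; rewrite /jump_stat -sumrB.
rewrite (bigD1 w) //= addrC; apply: le_trans (ler_normD _ _) _; apply: lerD.
  apply: le_trans (ler_norm_sum _ _ _) _; apply: ler_sum => v vw.
  rewrite -avgB; apply: avg_norm_le => // t.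
  apply: le_trans (psi_lip (M v) _ _ (XM _ _ _) (XM _ _ _)) _.
  by rewrite ler_wpM2l ?XK // mulr_ge0 // (le_trans _ (XM u v t)).
rewrite -avgB; apply: avg_norm_le => // t.
have M0 : 0 <= M w by rewrite (le_trans _ (XM u w t)).
apply: le_trans (psi_lip (M w) _ _ (XM _ _ _) _) _.
  exact: XM.
rewrite upd_upd opprB addrA subrK expr2 mulrA ler_wpM2l ?mulr_ge0 //.
Qed.

Lemma residual_invariantW v w f : invariant_at v f -> invariant_at v (residual w f).
Proof.
move=> fv u t; rewrite /residual fv; congr (_ - _); apply: eq_avg => s.
have [->|vw] := eqVneq v w; first by rewrite upd_upd.
by rewrite updC // fv.
Qed.

Lemma resamplesD s f g :
  resamples s (fun u => f u + g u) = fun u => resamples s f u + resamples s g u.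
Proof. by elim: s => //= v s ->; rewrite resampleD. Qed.

Lemma resamplesZ s c f : resamples s (fun u => c * f u) = fun u => c * resamples s f u.
Proof. by elim: s => //= v s ->; rewrite resampleZ. Qed.

(** Efron-Stein conditionally on the coordinates outside [P]. *)
Lemma efron_stein_partial (P : pred I) f :
  resamples (enum P) f = (fun=> 0) -> msq f <= \sum_(v | P v) msq (residual v f).
Proof.
move=> f0; apply: le_trans (efron_stein_seq (enum P) f) _.
by rewrite f0 {1}/msq avg_cst ?Omega_gt0 // expr0n /= add0r big_enum /= lexx.
Qed.

(** In terms of the Hoeffding decomposition, components of order two cancel on
    the left and the constant is subtracted; components of order one vanish by
    hypothesis.  What is left has order at least three, so Efron-Stein may be
    applied along three distinct coordinates in turn, each time the conditional
    mean being zero. *)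
Lemma regression_third_order (X : Omega -> R) :
  (forall w, resamples (enum (predC1 w)) X = fun=> avg X) ->
  msq (fun u => \sum_v residual v X u - 2 * (X u - avg X)) <=
  \sum_w \sum_(v | v != w) \sum_(x | (x != w) && (x != v))
    msq (residual x (residual v (residual w (fun u => X u +
      \sum_(y | (y != w) && (y != v) && (y != x)) residual y X u)))).
Proof.
move=> Xw; set Y := fun u => _.
have residual_const v (c : R) : residual v (fun=> c) = fun=> 0.
  exact: residual_invariant.
(* [residual w] is idempotent: one of the two copies of [residual w X] goes. *)
have Y1 w : residual w Y = fun u =>
    \sum_(v | v != w) residual v (residual w X) u - residual w X u.
  have -> : Y = fun u => (\sum_v residual v X u + -2 * X u) + 2 * avg X.
    by apply/funext => u; rewrite /Y; ring.
  rewrite 2!residualD residual_sum residual_const residualZ; apply/funext => u.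
  rewrite (bigD1 w) //= residual_idem.
  under eq_bigr do rewrite residualC.
  by ring.
have Y1_0 w : resamples (enum (predC1 w)) (residual w Y) = fun=> 0.
  rewrite Y1; have -> : (fun u => \sum_(v | v != w) residual v (residual w X) u -
    residual w X u) = fun u => \sum_(v | v != w) residual v (residual w X) u +
    -1 * residual w X u by apply/funext => u; rewrite mulN1r.
  rewrite resamplesD resamplesZ resamples_sum resamples_residual Xw residual_const.
  apply/funext => u; rewrite mulr0 addr0 big1 // => v vw.
  by rewrite resamples_residual0 // mem_enum.
(* Here the remaining copy cancels. *)
have Y2 w v : v != w -> residual v (residual w Y) = fun u =>
    \sum_(x | (x != w) && (x != v)) residual x (residual v (residual w X)) u.
  move=> vw; rewrite Y1; have -> : (fun u => \sum_(v | v != w) residual v (residual w X) u -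
    residual w X u) = fun u => \sum_(v | v != w) residual v (residual w X) u +
    -1 * residual w X u by apply/funext => u; rewrite mulN1r.
  rewrite residualD residualZ residual_sum; apply/funext => u.
  rewrite (bigD1 v) //= residual_idem mulN1r addrAC subrr add0r.
  by apply: eq_bigr => x _; rewrite residualC.
have Y2_0 w v : v != w ->
    resamples (enum [pred x | (x != w) && (x != v)]) (residual v (residual w Y)) = fun=> 0.
  move=> vw; rewrite Y2 // resamples_sum; apply/funext => u; rewrite big1 // => x xP.
  by rewrite resamples_residual0 // mem_enum.
have Y3 w v x : v != w -> (x != w) && (x != v) -> residual x (residual v (residual w Y)) =
    residual x (residual v (residual w (fun u => X u +
      \sum_(y | (y != w) && (y != v) && (y != x)) residual y X u))).
  move=> vw xP; rewrite Y2 // residual_sum (residualD w X) (residualD v (residual w X)).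
  rewrite (residualD x (residual v (residual w X))) !residual_sum; apply/funext => u.
  rewrite (bigD1 x) //= residual_idem; congr (_ + _); apply: eq_bigr => y _.
  by rewrite (residualC w y) (residualC v y).
have avgY : avg Y = 0.
  rewrite /Y avgB avg_sum avgZ avgB avg_cst ?Omega_gt0 // subrr mulr0 subr0.
  by rewrite big1 // => v _; rewrite /residual avgB avg_resample subrr.
apply: (@le_trans _ _ (\sum_w msq (residual w Y))).
  apply: le_trans (efron_stein _); rewrite avgY le_eqVlt; apply/orP; left.
  by apply/eqP; congr msq; apply/funext => u; rewrite subr0.
apply: ler_sum => w _; apply: le_trans (efron_stein_partial (Y1_0 w)) _.
apply: ler_sum => v vw; apply: le_trans (efron_stein_partial (Y2_0 w v vw)) _.
by apply: ler_sum => x xP; rewrite Y3.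
Qed.

(** Now let [X] be a sum of terms [x_ q], each a function of at most four
    coordinates [V q] with values in [[0, beta]].  A difference of [X] in the
    coordinates [A] sees only the terms with [A] inside [V q], whose total
    weight is [load A]. *)
Section local_statistic.
Context {Q : finType} (V : Q -> {set I}) (x_ : Q -> Omega -> R) (beta : R).
Hypothesis V_size : forall q, (#|V q| <= 4)%N.
Hypothesis x_local : forall q v, v \notin V q -> invariant_at v (x_ q).
Hypothesis x_bounds : forall q u, 0 <= x_ q u <= beta.
Local Notation X := (fun u => \sum_q x_ q u).

Definition load (A : {set I}) : R := beta * #|[set q | A \subset V q]|%SET%:R.

Lemma sum_load (F : Q -> R) (A : {set I}) (c : R) :
  (forall q, A \subset V q -> `|F q| <= c * beta) -> (forall q, ~~ (A \subset V q) -> F q = 0) ->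
  `|\sum_q F q| <= c * load A.
Proof.
move=> F1 F0; rewrite (bigID (fun q => A \subset V q)) /= [X in _ + X]big1 // addr0.
apply: le_trans (ler_norm_sum _ _ _) _; apply: le_trans (ler_sum _ F1) _.
rewrite (eq_bigl (fun q => q \in [set q | A \subset V q]%SET)) => [|q]; last by rewrite inE.
by rewrite sumr_const /load -[leLHS]mulr_natr mulrA lexx.
Qed.

Lemma local_jump u v t : `|X u - X (upd u v t)| <= load [set v]%SET.
Proof.
rewrite -sumrB -[leRHS]mul1r; apply: sum_load => q; rewrite finset.sub1set => vq.
  have /andP[h1 h2] := x_bounds q u; have /andP[h3 h4] := x_bounds q (upd u v t).
  by rewrite ler_norml; apply/andP; split; lra.
by rewrite x_local // subrr.
Qed.

Lemma local_jump2 u v w t s : v != w ->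
  `|X u - X (upd u v t) - (X (upd u w s) - X (upd (upd u w s) v t))|
    <= 2 * load [set v; w]%SET.
Proof.
move=> vw; rewrite -!sumrB; apply: sum_load => q; rewrite finset.subUset !finset.sub1set => vwq.
  have /andP[h1 h2] := x_bounds q u; have /andP[h3 h4] := x_bounds q (upd u v t).
  have /andP[h5 h6] := x_bounds q (upd u w s).
  have /andP[h7 h8] := x_bounds q (upd (upd u w s) v t).
  by rewrite ler_norml; apply/andP; split; lra.
move: vwq; rewrite negb_and => /orP[vq|wq].
  by rewrite !(x_local vq) // !subrr.
by rewrite updC 1?eq_sym // !(x_local wq) // subrr.
Qed.

Lemma residual_bounds (q : Q) v u : `|residual v (x_ q) u| <= beta.
Proof.
have -> : residual v (x_ q) u = avg (fun t => x_ q u - x_ q (upd u v t)).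
  by rewrite /residual /resample avgB avg_cst.
apply: avg_norm_le => // t.
have /andP[h1 h2] := x_bounds q u; have /andP[h3 h4] := x_bounds q (upd u v t).
by rewrite ler_norml; apply/andP; split; lra.
Qed.

(** Three residuals kill every term whose coordinates do not include [w], [v]
    and [x].  A surviving term has at most one further coordinate [y], so the
    inner sum adds at most one residual to it, and the three outer residuals
    contract the mean square. *)
Lemma local_third_order w v x : v != w -> (x != w) && (x != v) ->
  msq (residual x (residual v (residual w (fun u => X u +
      \sum_(y | (y != w) && (y != v) && (y != x)) residual y X u))))
  <= (2 * load [set w; v; x]%SET) ^+ 2.
Proof.
move=> vw /andP[xw xv].
pose P y := (y != w) && (y != v) && (y != x).
pose y_ q u := x_ q u + \sum_(y | P y) residual y (x_ q) u.
have -> : (fun u => X u + \sum_(y | P y) residual y X u) = fun u => \sum_q y_ q u.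
  apply/funext => u; rewrite [RHS]big_split /=; congr (_ + _).
  by under eq_bigr do rewrite residual_sum; rewrite exchange_big.
have y_inv q z : z \notin V q -> residual z (y_ q) = fun=> 0.
  move=> zq; apply: residual_invariant => u t; rewrite /y_ x_local //; congr (_ + _).
  by apply: eq_bigr => y _; rewrite residual_invariantW //; exact: x_local.
pose A := [set w; v; x]%SET.
have r0 z : residual z (fun=> 0) = (fun=> 0) :> (Omega -> R) by exact: residual_invariant.
have -> : residual x (residual v (residual w (fun u => \sum_q y_ q u))) =
    residual x (residual v (residual w (fun u => \sum_(q | A \subset V q) y_ q u))).
  rewrite !residual_sum; apply/funext => u.
  rewrite (bigID (fun q => A \subset V q)) /= [X in _ + X]big1 ?addr0 // => q.
  rewrite /A !finset.subUset !finset.sub1set !negb_and -orbA => /or3P[] zq.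
  - by rewrite (y_inv _ _ zq) !r0.
  - by rewrite (residualC v) (y_inv _ _ zq) !r0.
  - by rewrite (residualC v) (residualC x) (residualC x v) (y_inv _ _ zq) !r0.
do 3 apply: le_trans (msq_residual _ _) _.
apply: ler_msq => u.
rewrite big_mkcond /=; apply: sum_load => q; last by move=> /negPf ->.
move=> Aq; rewrite Aq /y_.
have -> : \sum_(y | P y) residual y (x_ q) u =
    \sum_(y in V q :\: A) residual y (x_ q) u.
  rewrite (bigID (mem (V q))) /= [X in _ + X]big1 ?addr0 => [|y /andP[_ yq]]; last first.
    by rewrite residual_invariant //; exact: x_local.
  apply: eq_bigl => y; rewrite !inE !negb_or /P; case: (y \in V q) => /=; rewrite ?andbT ?andbF //.
have A3 : #|A| = 3.
  by rewrite /A finset.setUC cardsU1 cards2 !inE negb_or xw xv eq_sym vw.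
have cVA : (#|V q :\: A| <= 1)%N.
  by rewrite cardsD (finset.setIidPr Aq) A3; have := V_size q; lia.
apply: le_trans (ler_normD _ _) _.
have -> : 2 * beta = beta + beta by ring.
apply: lerD; first by have /andP[h1 h2] := x_bounds q u; rewrite ger0_norm.
apply: le_trans (ler_norm_sum _ _ _) _.
apply: (@le_trans _ _ (\sum_(y in V q :\: A) beta)).
  by apply: ler_sum => y _; exact: residual_bounds.
rewrite sumr_const -mulr_natr ler_piMr ?(ler_nat _ _ 1) //.
by have /andP[] := x_bounds q u => h; apply: le_trans.
Qed.

End local_statistic.
End product_space.

(** * Crossing chords on a discrete circle *)
Section cyclic_order.
Context {N : nat}.
Implicit Types i j k l s t : 'I_N.+1.

Definition arc i j : nat := (j - i)%R.

(** The points [k] and [l] lie strictly on different sides of the chord [i j].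
    Written with arc lengths only, it is visibly invariant under rotation. *)
Definition interlaced i j k l : bool :=
  [&& (0 < arc i k)%N, (0 < arc i l)%N, arc i k != arc i j, arc i l != arc i j
    & (arc i k < arc i j)%N (+) (arc i l < arc i j)%N].

(** The pattern counted by [crossing]; it is not invariant under rotation, only
    the sum of its eight symmetric variants is. *)
Definition chain i j k l : bool := [&& (k < i)%N, (j < k)%N & (l < j)%N].

Lemma arcE i j : arc i j = if (i <= j)%N then (j - i)%N else (N.+1 + j - i)%N.
Proof.
rewrite /arc /=; case: leqP => ij; have := ltn_ord i; have := ltn_ord j => jN iN.
  case: (posnP i) => [->|i0]; first by rewrite subn0 modnn addn0 subn0 modn_small.
  rewrite (modn_small (m := N.+1 - i)); last by lia.
  by rewrite (_ : (j + (N.+1 - i) = (j - i) + N.+1)%N) ?modnDr ?modn_small //; lia.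
by rewrite (modn_small (m := N.+1 - i)) ?modn_small //; lia.
Qed.

Lemma arc_shift s i j : arc (i + s) (j + s) = arc i j.
Proof. by rewrite /arc opprD addrACA subrr addr0. Qed.

Lemma interlaced_shift s i j k l :
  interlaced (i + s) (j + s) (k + s) (l + s) = interlaced i j k l.
Proof. by rewrite /interlaced !arc_shift. Qed.

(** Two chords with distinct end points are interlaced in exactly one of the
    eight ways of naming the first chord and the first end of each chord. *)
Lemma interlacedE i j k l : interlaced i j k l =
  (chain i j k l + chain j i k l + chain i j l k + chain j i l k +
   chain k l i j + chain l k i j + chain k l j i + chain l k j i)%N :> nat.
Proof.
rewrite /interlaced /chain !arcE.
have := ltn_ord i; have := ltn_ord j; have := ltn_ord k; have := ltn_ord l.
move: (nat_of_ord i) (nat_of_ord j) (nat_of_ord k) (nat_of_ord l) => a b c d.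
case: (ltngtP a b) => ?; case: (ltngtP a c) => ?; case: (ltngtP b c) => ?;
  (try by exfalso; lia); case: (ltngtP a d) => ?; (try by exfalso; lia);
  case: (ltngtP b d) => ?; (try by exfalso; lia); case: (ltngtP c d) => ?; 
  (try by exfalso; lia); rewrite /= => *; lia.
Qed.

Lemma nat_of_bool_inj : injective nat_of_bool.
Proof. by case; case. Qed.

Lemma interlacedC i j k l : interlaced i j k l = interlaced j i k l.
Proof. by apply: nat_of_bool_inj; rewrite !interlacedE; lia. Qed.

Lemma interlaced_swap i j k l : interlaced i j k l = interlaced k l i j.
Proof. by apply: nat_of_bool_inj; rewrite !interlacedE; lia. Qed.

Lemma interlaced_neq i j k l : interlaced i j k l ->
  [/\ i != j, i != k & i != l] /\ [/\ j != k, j != l & k != l].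
Proof.
have arcxx t : arc t t = 0%N by rewrite /arc subrr.
move=> /and5P[ik il kj lj kl]; split; split.
- by apply: contraTneq kl => <-; rewrite arcxx !ltn0.
- by apply: contraTneq ik => <-; rewrite arcxx.
- by apply: contraTneq il => <-; rewrite arcxx.
- by apply: contraNneq kj => ->.
- by apply: contraNneq lj => ->.
- by apply: contraTneq kl => ->; rewrite addbb.
Qed.

End cyclic_order.

(** * Counting edges through given vertices *)
Section graph_counts.
Context {R : realType} {n : nat} (e : rel 'I_n).
Context (e_sym : symmetric e) (e_irr : irreflexive e).
Local Notation I := 'I_n.
Local Notation m := (#|edges e|%:R : R).
Local Notation Delta := ((max_degree e)%:R : R).
Implicit Types (v w x : I) (p : I * I).

Definition deg v : R := (degree e v)%:R.
(** Sums over edges are sums over ordered pairs weighted by [adj], which counts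
    every edge twice. *)
Definition adj p : R := (e p.1 p.2)%:R.
Definition hit v p : R := (p.1 == v)%:R + (p.2 == v)%:R.

Lemma sum_delta (A : finType) (a0 : A) (F : A -> R) : \sum_a (a == a0)%:R * F a = F a0.
Proof.
rewrite (bigD1 a0) //= eqxx mul1r big1 ?addr0 // => a /negPf ->.
by rewrite mul0r.
Qed.

Lemma sum_adj_row v : \sum_w adj (v, w) = deg v.
Proof.
rewrite /deg /degree -sum1_card natr_sum [RHS]big_mkcond /=.
by apply: eq_bigr => w _; rewrite inE /adj /=; case: (e v w).
Qed.

Lemma adjC v w : adj (v, w) = adj (w, v).
Proof. by rewrite /adj /= e_sym. Qed.

Lemma adj_ge0 p : 0 <= adj p. Proof. by rewrite ler0n. Qed.
Lemma adj_idem p : adj p * adj p = adj p.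
Proof. by rewrite /adj; case: (e _ _); rewrite ?mulr1 ?mulr0. Qed.
Lemma hit_ge0 v p : 0 <= hit v p. Proof. by rewrite addr_ge0. Qed.
Lemma deg_ge0 v : 0 <= deg v. Proof. by rewrite ler0n. Qed.
Lemma deg_le v : deg v <= Delta.
Proof. by rewrite ler_nat /max_degree; exact: leq_bigmax. Qed.

Lemma sum_pairs (F : I * I -> R) : \sum_p F p = \sum_v \sum_w F (v, w).
Proof. by rewrite pair_bigA /=; apply: eq_bigr => -[]. Qed.

Lemma sum_adj_deg : \sum_p adj p = \sum_v deg v.
Proof. by rewrite sum_pairs; apply: eq_bigr => v _; rewrite sum_adj_row. Qed.

(** An edge is the image of exactly two ordered pairs. *)
Lemma sum_adj : \sum_p adj p = 2 * m.
Proof.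
pose D := [set p : I * I | e p.1 p.2]%SET.
pose f p := [set p.1; p.2]%SET.
have -> : edges e = [set f p | p in D]%SET.
  apply/setP => E; apply/imsetP/imsetP => -[p pe ->]; exists p => //;
    by move: pe; rewrite ?inE.
have -> : \sum_p adj p = (\sum_(p in D) 1)%:R.
  rewrite natr_sum [RHS]big_mkcond /=; apply: eq_bigr => p _; rewrite inE /adj.
  by case: (e _ _).
rewrite (partition_big_imset f) /= -natrM mulnC -[X in _ = (X * 2)%:R]sum1_card big_distrl /=.
congr _%:R; apply: eq_bigr => E /imsetP[[a b]]; rewrite inE /= => eab ->.
rewrite mul1n sum1_card.
have anb : a != b by apply: contraTneq eab => ->; rewrite e_irr.
rewrite -[RHS](_ : #|[set (a, b); (b, a)]%SET| = 2)%N; last first.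
  by rewrite cards2 xpair_eqE negb_and anb.
apply: eq_card => -[c d]; rewrite !inE /= /f !xpair_eqE.
apply/andP/orP => [[]|[]/andP[/eqP -> /eqP ->]]; last 2 first.
- by rewrite inE eab eqxx.
- by rewrite inE /= e_sym eab finset.setUC eqxx.
rewrite inE /= => ecd /eqP E1; have cnd : c != d by apply: contraTneq ecd => ->; rewrite e_irr.
have : c \in [set a; b]%SET by rewrite -E1 !inE eqxx.
have : d \in [set a; b]%SET by rewrite -E1 !inE eqxx orbT.
rewrite !inE => /orP[]/eqP Ed /orP[]/eqP Ec; rewrite Ed Ec ?eqxx in cnd *; by auto.
Qed.

Lemma sum_deg : \sum_v deg v = 2 * m.
Proof. by rewrite -sum_adj_deg sum_adj. Qed.

Lemma sum_deg_sqr : \sum_v deg v ^+ 2 <= Delta * (2 * m).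
Proof.
rewrite -sum_deg mulr_sumr; apply: ler_sum => v _.
by rewrite expr2 ler_wpM2r ?deg_ge0 // deg_le.
Qed.

Lemma sum_adj_hit v : \sum_p adj p * hit v p = 2 * deg v.
Proof.
rewrite sum_pairs /hit /=.
under eq_bigr do under eq_bigr do rewrite mulrDr ![adj _ * _]mulrC.
under eq_bigr do rewrite big_split /= -mulr_sumr sum_delta.
rewrite big_split /= sum_delta sum_adj_row.
under eq_bigr do rewrite adjC.
by rewrite sum_adj_row; ring.
Qed.

Lemma delta_neq (a v w : I) : v != w -> (a == v)%:R * (a == w)%:R = 0 :> R.
Proof. by move=> vw; have [->|] := eqVneq a v; rewrite ?(negPf vw) ?mulr0 ?mul0r. Qed.

Lemma sum_adj_hit2 v w : v != w -> \sum_p adj p * hit v p * hit w p = 2 * adj (v, w).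
Proof.
move=> vw; rewrite (eq_bigr (fun p => (p == (v, w))%:R * adj p + (p == (w, v))%:R * adj p)).
  by rewrite big_split /= !sum_delta adjC; ring.
move=> [a b] _; rewrite /hit /= !xpair_eqE -!mulnb !natrM.
have h1 := delta_neq a vw; have h2 := delta_neq b vw.
rewrite -[RHS]addr0 -[X in _ = _ + X](mulr0 (adj (a, b))) -(addr0 0) -{1}h1 -h2.
by ring.
Qed.

(** An edge has only two ends. *)
Lemma hit3_eq0 v w x p : v != w -> w != x -> v != x -> hit v p * hit w p * hit x p = 0.
Proof.
move=> vw wx vx; rewrite /hit; case: p => a b /=.
have h1 := delta_neq a vw; have h2 := delta_neq b vw.
have h3 := delta_neq a wx; have h4 := delta_neq b wx.
have h5 := delta_neq a vx; have h6 := delta_neq b vx.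
move: h1 h2 h3 h4 h5 h6.
move: (a == v)%:R (a == w)%:R (a == x)%:R => a1 a2 a3.
move: (b == v)%:R (b == w)%:R (b == x)%:R => b1 b2 b3 h1 h2 h3 h4 h5 h6.
transitivity ((a1 * a2) * (a3 + b3) + (b1 * b2) * (a3 + b3) + (a1 * a3) * b2 +
  a1 * (b2 * b3) + b1 * (a2 * a3) + (b1 * b3) * a2); first by ring.
by rewrite h1 h2 h3 h4 h5 h6; ring.
Qed.

Section crossing_statistic.
Context {N : nat}.
Local Notation Omega := {ffun I -> 'I_N.+1}.
Local Notation Q := ((I * I) * (I * I))%type.
Implicit Types (q : Q) (u : Omega).

Lemma grid_gt0 : (0 < #|'I_N.+1|)%N.
Proof. by rewrite card_ord. Qed.

Definition cross q u : R :=
  (interlaced (u q.1.1) (u q.1.2) (u q.2.1) (u q.2.2))%:R.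

(** Pairs of non-edges contribute a null term to the crossing number; giving
    them no vertices keeps them out of the loads. *)
Definition verts q : {set I} :=
  if e q.1.1 q.1.2 && e q.2.1 q.2.2 then [set q.1.1; q.1.2; q.2.1; q.2.2]%SET
  else finset.set0.

(** The factor [8^-1] accounts for the eight ordered quadruples that describe
    one pair of edges. *)
Definition crossing_term q u : R := 8^-1 * (adj q.1 * adj q.2 * cross q u).
Definition grid_crossings u : R := \sum_q crossing_term q u.

Lemma crossing_term_bounds q u : 0 <= crossing_term q u <= 8^-1.
Proof.
rewrite /crossing_term /adj /cross; do 2 (case: (e _ _)); case: (interlaced _ _ _ _);
  rewrite ?mulr1n ?mulr0n ?mulr0 ?mul0r ?mulr1; by apply/andP; split; lra.
Qed.

Lemma cross_local q v : v \notin [set q.1.1; q.1.2; q.2.1; q.2.2]%SET ->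
  invariant_at v (cross q).
Proof.
rewrite !inE !negb_or => /andP[/andP[/andP[h1 h2] h3] h4] u t.
by rewrite /cross !upd_neq // eq_sym.
Qed.

Lemma crossing_term_local q v : v \notin verts q -> invariant_at v (crossing_term q).
Proof.
rewrite /verts => vq u t; rewrite /crossing_term.
move: vq; case: ifP => [_ /cross_local -> //|/negbT]; rewrite negb_and /adj.
by move=> /orP[]/negPf -> _; rewrite !(mul0r, mulr0).
Qed.

Lemma verts_size q : (#|verts q| <= 4)%N.
Proof.
rewrite /verts; case: ifP => _; last by rewrite cards0.
apply: leq_trans (leq_card_setU _ _) _; rewrite cards1 addn1 ltnS.
apply: leq_trans (leq_card_setU _ _) _; rewrite cards1 addn1 ltnS.
by rewrite cards2; case: (_ == _).
Qed.

(** Replaces the indicator that all of [A] occurs by a product of [hit]s, so that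
    the sum over quadruples factors into sums over edges. *)
Lemma load_le (A : {set I}) (F : Q -> R) : A != finset.set0 ->
  (forall q, 0 <= F q) ->
  (forall q, A \subset [set q.1.1; q.1.2; q.2.1; q.2.2]%SET -> 1 <= F q) ->
  load verts 8^-1 A <= 8^-1 * \sum_q adj q.1 * adj q.2 * F q.
Proof.
move=> A0 F0 F1; rewrite /load ler_wpM2l ?invr_ge0 //.
rewrite -sum1_card natr_sum big_mkcond /=; apply: ler_sum => q _; rewrite inE.
case: ifP => [|_]; last by rewrite !mulr_ge0 ?adj_ge0.
rewrite /verts /adj; case: (e _ _); case: (e _ _) => /=.
- by move=> /F1; rewrite mulr1n !mul1r.
all: by rewrite finset.subset0 (negPf A0).
Qed.

Lemma sum_quads (F G : I * I -> R) :
  \sum_(q : Q) F q.1 * G q.2 = (\sum_p F p) * (\sum_p G p).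
Proof. by rewrite mulr_suml -(pair_big xpredT xpredT (fun p p' => F p * G p')) /=;
  apply: eq_bigr => p _; rewrite mulr_sumr. Qed.

Lemma hit_mem v q : v \in [set q.1.1; q.1.2; q.2.1; q.2.2]%SET ->
  1 <= hit v q.1 + hit v q.2.
Proof.
have n0 (b : bool) : (b%:R : R) >= 0 by rewrite ler0n.
have h1 := n0 (q.1.1 == v); have h2 := n0 (q.1.2 == v).
have h3 := n0 (q.2.1 == v); have h4 := n0 (q.2.2 == v).
rewrite !inE /hit !(eq_sym v) -orbA -orbA => /or4P[] -> ; rewrite mulr1n; lra.
Qed.

Lemma load1_le v : load verts 8^-1 [set v]%SET <= deg v * m.
Proof.
apply: le_trans (load_le (F := fun q => hit v q.1 + hit v q.2) _ _ _) _.
- by apply/set0Pn; exists v; rewrite inE.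
- by move=> q; rewrite addr_ge0 ?hit_ge0.
- by move=> q; rewrite finset.sub1set; exact: hit_mem.
rewrite (eq_bigr (fun q => (adj q.1 * hit v q.1) * adj q.2 +
  adj q.1 * (adj q.2 * hit v q.2))); last by move=> q _; ring.
rewrite big_split /= (sum_quads (fun p => adj p * hit v p) adj).
rewrite (sum_quads adj (fun p => adj p * hit v p)) sum_adj sum_adj_hit.
by rewrite le_eqVlt; apply/orP; left; apply/eqP; field.
Qed.

Lemma load2_le v w : v != w ->
  load verts 8^-1 [set v; w]%SET <= deg v * deg w + m * adj (v, w).
Proof.
move=> vw.
apply: le_trans (load_le
  (F := fun q => (hit v q.1 + hit v q.2) * (hit w q.1 + hit w q.2)) _ _ _) _.
- by apply/set0Pn; exists v; rewrite !inE eqxx.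
- by move=> q; rewrite mulr_ge0 // addr_ge0 ?hit_ge0.
- move=> q; rewrite finset.subUset !finset.sub1set => /andP[/hit_mem h1 /hit_mem h2].
  by rewrite -[leLHS]mulr1; apply: ler_pM.
rewrite (eq_bigr (fun q => ((adj q.1 * hit v q.1 * hit w q.1) * adj q.2 +
    adj q.1 * (adj q.2 * hit v q.2 * hit w q.2)) +
  ((adj q.1 * hit v q.1) * (adj q.2 * hit w q.2) +
   (adj q.1 * hit w q.1) * (adj q.2 * hit v q.2)))); last by move=> q _; ring.
rewrite !big_split /= (sum_quads (fun p => adj p * hit v p * hit w p) adj).
rewrite (sum_quads adj (fun p => adj p * hit v p * hit w p)).
rewrite (sum_quads (fun p => adj p * hit v p) (fun p => adj p * hit w p)).
rewrite (sum_quads (fun p => adj p * hit w p) (fun p => adj p * hit v p)).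
rewrite sum_adj !sum_adj_hit sum_adj_hit2 //.
by rewrite le_eqVlt; apply/orP; left; apply/eqP; field.
Qed.

(** Of three vertices on two edges, two are the ends of the same edge. *)
Lemma load3_le v w x : v != w -> w != x -> v != x ->
  load verts 8^-1 [set v; w; x]%SET <=
  adj (v, w) * deg x + adj (w, x) * deg v + adj (v, x) * deg w.
Proof.
move=> vw wx vx.
apply: le_trans (load_le (F := fun q => (hit v q.1 + hit v q.2) *
  (hit w q.1 + hit w q.2) * (hit x q.1 + hit x q.2)) _ _ _) _.
- by apply/set0Pn; exists v; rewrite !inE eqxx.
- by move=> q; rewrite !mulr_ge0 // addr_ge0 ?hit_ge0.
- move=> q; rewrite !finset.subUset !finset.sub1set.
  move=> /andP[/andP[/hit_mem h1 /hit_mem h2] /hit_mem h3].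
  rewrite -[leLHS]mulr1 -[X in X * _ <= _]mulr1.
  by apply: ler_pM => //; apply: ler_pM.
rewrite (eq_bigr (fun q =>
  ((adj q.1 * hit v q.1 * hit w q.1) * (adj q.2 * hit x q.2) +
   (adj q.1 * hit x q.1) * (adj q.2 * hit v q.2 * hit w q.2)) +
  ((adj q.1 * hit w q.1 * hit x q.1) * (adj q.2 * hit v q.2) +
   (adj q.1 * hit v q.1) * (adj q.2 * hit w q.2 * hit x q.2)) +
  ((adj q.1 * hit v q.1 * hit x q.1) * (adj q.2 * hit w q.2) +
   (adj q.1 * hit w q.1) * (adj q.2 * hit v q.2 * hit x q.2)))); last first.
  move=> q _; have := hit3_eq0 q.1 vw wx vx; have := hit3_eq0 q.2 vw wx vx.
  move: (hit v q.1) (hit w q.1) (hit x q.1) => a1 a2 a3.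
  move: (hit v q.2) (hit w q.2) (hit x q.2) => b1 b2 b3 hb ha.
  apply/eqP; rewrite -subr_eq0; apply/eqP.
  transitivity (adj q.1 * adj q.2 * (a1 * a2 * a3 + b1 * b2 * b3)); first by ring.
  by rewrite ha hb addr0 mulr0.
rewrite !big_split /=.
rewrite (sum_quads (fun p => adj p * hit v p * hit w p) (fun p => adj p * hit x p)).
rewrite (sum_quads (fun p => adj p * hit x p) (fun p => adj p * hit v p * hit w p)).
rewrite (sum_quads (fun p => adj p * hit w p * hit x p) (fun p => adj p * hit v p)).
rewrite (sum_quads (fun p => adj p * hit v p) (fun p => adj p * hit w p * hit x p)).
rewrite (sum_quads (fun p => adj p * hit v p * hit x p) (fun p => adj p * hit w p)).
rewrite (sum_quads (fun p => adj p * hit w p) (fun p => adj p * hit v p * hit x p)).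
rewrite !sum_adj_hit !sum_adj_hit2 //.
by rewrite le_eqVlt; apply/orP; left; apply/eqP; field.
Qed.

End crossing_statistic.
End graph_counts.

(** * Rotation invariance *)
Section rotation.
Context {R : realType} {I : finType} {N : nat}.
Local Notation Omega := {ffun I -> 'I_N.+1}.
Implicit Types (u : Omega) (f : Omega -> R).

Definition rotate (s : 'I_N.+1) u : Omega := [ffun i => u i + s].

Lemma resample_rotate s v f : resample v (fun u => f (rotate s u)) = fun u => resample v f (rotate s u).
Proof.
apply/funext => u; rewrite /resample /avg; congr (_ / _).
rewrite [RHS](reindex_inj (addIr s)) /=; apply: eq_bigr => t _.
by congr f; apply/ffunP => i; rewrite !ffunE; case: eqP.
Qed.

Lemma resamples_rotate s r f : resamples r (fun u => f (rotate s u)) = fun u => resamples r f (rotate s u).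
Proof. by elim: r => //= v r ->; rewrite resample_rotate. Qed.

(** The conditional mean given the position of one vertex is invariant under
    rotation, which acts transitively on the positions. *)
Lemma rotation_invariant_first_order f w : (forall s u, f (rotate s u) = f u) ->
  resamples (enum (predC1 w)) f = fun=> avg f.
Proof.
move=> f_rot; have cardT : (0 < #|'I_N.+1|)%N by rewrite card_ord.
apply/funext => u; rewrite -(avg_resamples cardT (enum (predC1 w)) f).
set g := resamples _ _.
rewrite -(avg_cst (Omega_gt0 (I := I) cardT) (g u)); apply: eq_avg => u'.
have g_rot s x : g (rotate s x) = g x.
  rewrite /g; have <- := congr1 (@^~ x) (resamples_rotate s (enum (predC1 w)) f).
  by rewrite (_ : (fun y => f (rotate s y)) = f) //; apply/funext => y.
rewrite -(g_rot (u' w - u w)); apply: (@invariant_agree _ _ _ (predC1 w)).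
  by move=> v vw; apply: resamples_invariant => //; rewrite mem_enum.
by move=> v; rewrite /= negbK => /eqP ->; rewrite ffunE subrKC.
Qed.

End rotation.

(** * The normal approximation on the circle *)
Section grid_bound.
Context {R : realType} {n N : nat} (e : rel 'I_n).
Context (e_sym : symmetric e) (e_irr : irreflexive e).
Local Notation Omega := {ffun 'I_n -> 'I_N.+1}.
Local Notation m := (#|edges e|%:R : R).
Local Notation Delta := ((max_degree e)%:R : R).
Local Notation X := (@grid_crossings R n e N).
Local Notation adj := (@adj R n e).
Local Notation deg := (@deg R n e).
Local Notation gt0 := (@grid_gt0 N).
Implicit Types (u : Omega) (v w x : 'I_n).

Lemma grid_crossings_rotate s u : X (rotate s u) = X u.
Proof.
apply: eq_bigr => q _; congr (_ * (_ * _)); rewrite /cross !ffunE.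
by rewrite interlaced_shift.
Qed.

(** Efron-Stein with [M v = deg v * m] and
    [K v w = 2 * (deg v * deg w + m * adj (v, w))]: the influence of the vertex
    [w] is at most [14 * m ^ 2 * Delta * deg w], and
    [\sum_w deg w ^ 2 <= 2 * m * Delta]. *)
Lemma grid_jump_variance (psi : R -> R) :
  (forall L x y : R, `|x| <= L -> `|y| <= L -> `|psi x - psi y| <= 2 * L * `|x - y|) ->
  msq (fun u => jump_stat psi X u - avg (jump_stat psi X)) <=
  (20 * m ^+ 2 * Num.sqrt m * Delta ^+ 2) ^+ 2.
Proof.
move=> psi_lip; have m0 : 0 <= m by rewrite ler0n.
have D0 : 0 <= Delta by rewrite ler0n.
have XM u v t : `|X u - X (upd u v t)| <= deg v * m.
  apply: le_trans (load1_le e_sym e_irr v).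
  by apply: local_jump => // *; [exact: crossing_term_local|exact: crossing_term_bounds].
have XK u v w t s : v != w ->
    `|X u - X (upd u v t) - (X (upd u w s) - X (upd (upd u w s) v t))| <=
    2 * (deg v * deg w + m * adj (v, w)).
  move=> vw; apply: (@le_trans _ _ (2 * load (verts e) 8^-1 [set v; w]%SET)).
    by apply: local_jump2 => // *; [exact: crossing_term_local|exact: crossing_term_bounds].
  by rewrite ler_wpM2l // load2_le.
apply: le_trans (jump_stat_variance gt0 psi_lip XM XK) _.
have c_le w : \sum_(v | v != w) 2 * (deg v * m) * (2 * (deg v * deg w + m * adj (v, w)))
    + 2 * (deg w * m) ^+ 2 <= 14 * m ^+ 2 * Delta * deg w.
  have h1 : \sum_(v | v != w) 2 * (deg v * m) * (2 * (deg v * deg w + m * adj (v, w))) <=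
      \sum_v (4 * m * deg w * deg v ^+ 2 + 4 * m ^+ 2 * Delta * adj (w, v)).
    rewrite big_mkcond /=; apply: ler_sum => v _.
    have dv := deg_ge0 (R := R) e v; have dw := deg_ge0 (R := R) e w; have dD := deg_le (R := R) e v.
    have a0 := adj_ge0 (R := R) e (w, v).
    case: ifP => _; last by rewrite addr_ge0 ?mulr_ge0 ?sqr_ge0.
    rewrite (adjC e_sym) -subr_ge0.
    rewrite (_ : _ - _ = 4 * m ^+ 2 * (Delta - deg v) * adj (w, v)); last by ring.
    by rewrite !mulr_ge0 ?sqr_ge0 // subr_ge0.
  have h2 : (deg w * m) ^+ 2 <= m ^+ 2 * Delta * deg w.
    rewrite exprMn mulrC -mulrA ler_wpM2l ?sqr_ge0 // expr2.
    by rewrite ler_wpM2r ?deg_ge0 ?deg_le.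
  have h3 : \sum_v (4 * m * deg w * deg v ^+ 2 + 4 * m ^+ 2 * Delta * adj (w, v)) <=
      12 * m ^+ 2 * Delta * deg w.
    rewrite big_split /= -!mulr_sumr sum_adj_row.
    have := ler_wpM2l (_ : 0 <= 4 * m * deg w) (sum_deg_sqr (R := R) e_sym e_irr).
    rewrite !mulr_ge0 ?deg_ge0 // => /(_ isT); lra.
  by lra.
apply: (@le_trans _ _ (\sum_w (14 * m ^+ 2 * Delta * deg w) ^+ 2)).
  apply: ler_sum => w _; rewrite lerXn2r ?nnegrE //.
    rewrite addr_ge0 // ?mulr_ge0 ?sqr_ge0 //.
    by apply: sumr_ge0 => v _; rewrite !mulr_ge0 ?addr_ge0 ?mulr_ge0 ?deg_ge0 ?adj_ge0.
  by rewrite !mulr_ge0 ?sqr_ge0 ?deg_ge0.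
under eq_bigr do rewrite exprMn.
rewrite -mulr_sumr.
apply: le_trans (ler_wpM2l (sqr_ge0 _) (sum_deg_sqr e_sym e_irr)) _.
rewrite [leRHS]exprMn 2![in leRHS]exprMn sqr_sqrtr //.
have D34 : Delta ^+ 3 <= Delta ^+ 4.
  by rewrite -!natrX ler_nat; case: (max_degree e) => // k; rewrite leq_pexp2l.
have m5 : 0 <= m ^+ 5 by rewrite exprn_ge0.
have D3 : 0 <= Delta ^+ 3 by rewrite exprn_ge0.
have h := ler_wpM2l m5 D34; have h' := mulr_ge0 m5 D3.
rewrite [leLHS](_ : _ = 392 * (m ^+ 5 * Delta ^+ 3)); last by ring.
by rewrite [leRHS](_ : _ = 400 * (m ^+ 5 * Delta ^+ 4)); [lra|ring].
Qed.

Lemma grid_regression :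
  msq (fun u => \sum_v residual v X u - 2 * (X u - avg X)) <= 144 * m ^+ 2 * Delta.
Proof.
have X1 w := rotation_invariant_first_order w grid_crossings_rotate.
apply: le_trans (regression_third_order gt0 X1) _.
apply: (@le_trans _ _ (\sum_w \sum_v \sum_x 12 *
  (adj (w, v) * deg x ^+ 2 + adj (v, x) * deg w ^+ 2 + adj (w, x) * deg v ^+ 2))).
  have F0 w v x : 0 <= 12 *
      (adj (w, v) * deg x ^+ 2 + adj (v, x) * deg w ^+ 2 + adj (w, x) * deg v ^+ 2).
    by rewrite mulr_ge0 // !addr_ge0 // mulr_ge0 ?adj_ge0 ?sqr_ge0.
  apply: ler_sum => w _; rewrite big_mkcond /=; apply: ler_sum => v _.
  case: ifP => vw; last by rewrite sumr_ge0.
  rewrite big_mkcond /=; apply: ler_sum => x _; case: ifP => // xP.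
  have L : load (verts e) 8^-1 [set w; v; x]%SET <=
      adj (w, v) * deg x + adj (v, x) * deg w + adj (w, x) * deg v.
    move/andP: xP => [xw xv]; apply: load3_le => //; by rewrite eq_sym.
  apply: (@le_trans _ _ ((2 * load (verts e) 8^-1 [set w; v; x]%SET) ^+ 2)).
    exact: (@local_third_order _ _ _ gt0 _ (verts e) (fun q => crossing_term e q) _
      (verts_size e) (@crossing_term_local R n e N) (crossing_term_bounds e)).
  have L0 : (0 : R) <= load (verts e) 8^-1 [set w; v; x]%SET by rewrite /load mulr_ge0.
  apply: (@le_trans _ _ ((2 * (adj (w, v) * deg x + adj (v, x) * deg w + adj (w, x) * deg v)) ^+ 2)).
    by rewrite lerXn2r ?nnegrE ?mulr_ge0 ?(le_trans L0 L) // ler_wpM2l.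
  have a1 := adj_idem (R := R) e (w, v); have a2 := adj_idem (R := R) e (v, x).
  have a3 := adj_idem (R := R) e (w, x).
  rewrite -[in leRHS]a1 -[in leRHS]a2 -[in leRHS]a3; move: (adj (w, v)) (adj (v, x)) (adj (w, x)) => p1 p2 p3.
  move: (deg w) (deg v) (deg x) => d1 d2 d3.
  set A := p1 * d3; set B := p2 * d1; set C := p3 * d2.
  have hAB := sqr_ge0 (A - B); have hBC := sqr_ge0 (B - C); have hAC := sqr_ge0 (A - C).
  rewrite [leRHS](_ : _ = 12 * (A ^+ 2 + B ^+ 2 + C ^+ 2)); last by rewrite /A /B /C; ring.
  by lra.
have S2 := sum_deg_sqr (R := R) e_sym e_irr.
have E : \sum_w \sum_v \sum_x 12 *
    (adj (w, v) * deg x ^+ 2 + adj (v, x) * deg w ^+ 2 + adj (w, x) * deg v ^+ 2) =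
    36 * (2 * m) * \sum_v deg v ^+ 2.
  set S := \sum_v deg v ^+ 2.
  have row v : \sum_x adj (v, x) = deg v := sum_adj_row e v.
  have tot := sum_deg (R := R) e_sym e_irr.
  transitivity (\sum_w \sum_v 12 * (adj (w, v) * S + deg v * deg w ^+ 2 + deg w * deg v ^+ 2)).
    apply: eq_bigr => w _; apply: eq_bigr => v _.
    by rewrite -mulr_sumr !big_split /= -mulr_sumr -!mulr_suml !row.
  transitivity (\sum_w 12 * (deg w * S + 2 * m * deg w ^+ 2 + deg w * S)).
    apply: eq_bigr => w _.
    by rewrite -mulr_sumr !big_split /= -mulr_sumr -!mulr_suml row tot.
  rewrite -mulr_sumr !big_split /= -!mulr_suml -mulr_sumr tot -/S.
  by ring.
rewrite E; have m0 : 0 <= 36 * (2 * m) by rewrite !mulr_ge0.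
by apply: le_trans (ler_wpM2l m0 S2) _; rewrite le_eqVlt; apply/orP; left; apply/eqP; ring.
Qed.

Lemma sqr_lip (L x y : R) : `|x| <= L -> `|y| <= L -> `|x ^+ 2 - y ^+ 2| <= 2 * L * `|x - y|.
Proof.
move=> xL yL; rewrite subr_sqr normrM mulrC ler_wpM2r //.
by apply: le_trans (ler_normD _ _) _; lra.
Qed.

Lemma mul_norm_lip (L x y : R) : `|x| <= L -> `|y| <= L ->
  `|x * `|x| - y * `|y| | <= 2 * L * `|x - y|.
Proof.
move=> xL yL; rewrite (_ : _ - _ = (x - y) * `|x| + y * (`|x| - `|y|)); last by ring.
apply: le_trans (ler_normD _ _) _; rewrite !normrM normr_id.
have := ler_wpM2l (normr_ge0 (x - y)) xL.
have := ler_pM (normr_ge0 _) (normr_ge0 _) yL (ler_dist_dist x y).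
lra.
Qed.

(** [stein_bound] for the standardised crossing number, with
    [b = c = 20 * m ^ 2 * sqrt m * Delta ^ 2 / sigma ^ 2] and
    [r = 6 * m * Delta ^ 2 / sigma]. *)
Theorem grid_berry_esseen (z sigma : R) : 0 < sigma ->
  sigma ^+ 2 = msq (fun u => X u - avg X) ->
  `|avg (fun u => ((X u - avg X) / sigma <= z)%R%:R) - Phi z| <=
  15 * (m ^+ 2 * Num.sqrt m * Delta ^+ 2) / sigma ^+ 2 + 18 * (m * Delta ^+ 2) / sigma.
Proof.
move=> s0 s2.
have sn0 : sigma != 0 by rewrite gt_eqF.
have m0 : 0 <= m by rewrite ler0n.
have D0 : 0 <= Delta by rewrite ler0n.
pose W u := sigma^-1 * (X u - avg X).
have msqZ c (f : Omega -> R) : msq (fun u => c * f u) = c ^+ 2 * msq f.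
  by rewrite /msq -avgZ; apply: eq_avg => u; rewrite exprMn.
have W1 : msq W = 1 by rewrite msqZ -s2 exprVn mulVf // expf_neq0.
have W0 : avg (fun u => ((X u - avg X) / sigma <= z)%R%:R) = avg (fun u => (W u <= z)%R%:R) :> R.
  by apply: eq_avg => u; rewrite /W mulrC.
set c0 := m ^+ 2 * Num.sqrt m * Delta ^+ 2.
have c00 : 0 <= c0 by rewrite !mulr_ge0 ?sqr_ge0 ?sqrtr_ge0.
pose b := 20 * c0 / sigma ^+ 2; pose r := 6 * (m * Delta ^+ 2) / sigma.
have b0 : 0 <= b by rewrite !mulr_ge0 // invr_ge0 sqr_ge0.
have r0 : 0 <= r by rewrite !mulr_ge0 ?sqr_ge0 // invr_ge0 ltW.
have jumps (psi : R -> R) : (forall x : R, psi (sigma^-1 * x) = (sigma ^+ 2)^-1 * psi x) ->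
    (forall L x y : R, `|x| <= L -> `|y| <= L -> `|psi x - psi y| <= 2 * L * `|x - y|) ->
    msq (fun u => jump_stat psi W u - avg (jump_stat psi W)) <= b ^+ 2.
  move=> psiZ psi_lip; rewrite /W (jump_stat_scale _ _ psiZ) avgZ.
  have -> : (fun u => (sigma ^+ 2)^-1 * jump_stat psi X u - (sigma ^+ 2)^-1 * avg (jump_stat psi X))
      = fun u => (sigma ^+ 2)^-1 * (jump_stat psi X u - avg (jump_stat psi X)).
    by apply/funext => u; rewrite mulrBr.
  rewrite msqZ; apply: le_trans (ler_wpM2l (sqr_ge0 _) (grid_jump_variance psi_lip)) _.
  rewrite -exprMn le_eqVlt; apply/orP; left; apply/eqP; congr (_ ^+ 2).
  by rewrite /b /c0; ring.
have jump_sqr := jumps _ _ sqr_lip; have jump_signed := jumps _ _ mul_norm_lip.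
apply: (@le_trans _ _ (b / 4 + 3 * r + b / 2)); last first.
  by rewrite /b /r; lra.
rewrite W0; apply: (stein_bound gt0 W1) => //.
- by apply: jump_sqr => x; rewrite exprMn exprVn.
- have -> : msq (jump_stat (fun x : R => x * `|x|) W) = 
      msq (fun u => jump_stat (fun x : R => x * `|x|) W u -
        avg (jump_stat (fun x : R => x * `|x|) W)).
    suff -> : avg (jump_stat (fun x : R => x * `|x|) W) = 0.
      by congr msq; apply/funext => u; rewrite subr0.
    rewrite avg_sum big1 // => v _.
    apply: (avg_antisym v (F := fun u u' => (W u - W u') * `|W u - W u'|)) => u u'.
    by rewrite -(opprB (W u')) normrN mulNr.
  apply: jump_signed => x; rewrite normrM ger0_norm ?invr_ge0 ?ltW //.
  by rewrite -exprVn; ring.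
have -> : regression_error W = fun u =>
    (2 * sigma)^-1 * (\sum_v residual v X u - 2 * (X u - avg X)).
  apply/funext => u; rewrite /regression_error.
  have -> : \sum_v residual v W u = sigma^-1 * \sum_v residual v X u.
    rewrite mulr_sumr; apply: eq_bigr => v _; rewrite /W residualZ; congr (_ * _).
    by rewrite /residual /resample avgB avg_cst ?gt0 //; ring.
  by rewrite /W; field.
rewrite msqZ; apply: le_trans (ler_wpM2l (sqr_ge0 _) grid_regression) _.
have D12 : Delta <= Delta ^+ 4.
  by rewrite -natrX ler_nat; case: (max_degree e) => // k; rewrite -[X in (X <= _)%N]expn1 leq_pexp2l.
rewrite /r; have -> : (6 * (m * Delta ^+ 2) / sigma) ^+ 2 =
   (2 * sigma)^-1 ^+ 2 * (144 * m ^+ 2 * Delta ^+ 4) by field.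
by rewrite ler_wpM2l ?sqr_ge0 // ler_wpM2l // mulr_ge0 ?sqr_ge0.
Qed.

End grid_bound.

(** * Correlation of a crossing with the length of its chords *)
Section sector.
Context {R : realType} {N : nat}.
Implicit Types (i j k l : 'I_N.+1).

(** The number of ordered pairs separated by a chord that spans an arc of length
    [x]. *)
Definition pair_count (x : nat) : R := (2 * (x.-1 * (N - x)))%N%:R.

Lemma arcD i t : arc i (t + i) = t.
Proof. by rewrite /arc addrK. Qed.

Lemma sum_arc (F : nat -> R) i : \sum_j F (arc i j) = \sum_(j < N.+1) F j.
Proof.
by rewrite (reindex_inj (addIr i)) /=; apply: eq_bigr => j _; rewrite arcD.
Qed.

Lemma sum_arc_left (F : nat -> R) j : \sum_i F (arc i j) = \sum_(i < N.+1) F i.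
Proof.
rewrite (reindex_inj (h := fun t => j - t)) /=; last first.
  by move=> t t' /addrI/oppr_inj.
by apply: eq_bigr => t _; rewrite /arc subKr.
Qed.

Lemma sum_between (K x : nat) : (\sum_(0 <= y < K) (0 < y < x)%N = (minn K x).-1)%N.
Proof.
elim: K => [|K IH]; first by rewrite big_geq //; lia.
by rewrite big_nat_recr //= IH; lia.
Qed.

Lemma sum_above (K x : nat) : (\sum_(0 <= y < K) (x < y)%N = K.-1 - x)%N.
Proof.
elim: K => [|K IH]; first by rewrite big_geq //; lia.
by rewrite big_nat_recr //= IH; lia.
Qed.

Lemma sum_interlaced i j :
  \sum_k \sum_l (interlaced i j k l)%:R = pair_count (arc i j).
Proof.
rewrite /pair_count; set x := arc i j.
have xN : (x < N.+1)%N by exact: ltn_ord.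
rewrite (reindex_inj (addIr i)) /=.
have inner k : \sum_l (interlaced i j (k + i) l)%:R =
    (\sum_(l < N.+1) ((0 < k < x) * (x < l) + (x < k) * (0 < l < x))%N)%:R :> R.
  rewrite (reindex_inj (addIr i)) /= natr_sum; apply: eq_bigr => l _; congr _%:R.
  rewrite /interlaced !arcD -/x; move: (nat_of_ord k) (nat_of_ord l) => a b; lia.
under eq_bigr do rewrite inner.
rewrite -natr_sum; congr _%:R.
under eq_bigr do rewrite big_split /= -!big_distrr /=.
rewrite big_split /= -!big_distrl /=.
rewrite -(big_mkord xpredT (fun y => (x < y)%N : nat)).
rewrite -(big_mkord xpredT (fun y => (0 < y < x)%N : nat)).
rewrite sum_between sum_above; lia.
Qed.

Context {M : nat} (NM : N.+1 = (4 * M)%N).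

(** Positive on the half of the circle opposite to the origin.  Long chords are
    crossed more often, and the two values are equally frequent because the
    circle has [4 * M] points. *)
Definition arc_sign (x : nat) : R := if (M <= x < 3 * M)%N then 1 else -1.
Lemma big_split_quarters (F : nat -> R) :
  \sum_(j < N.+1) F j = \sum_(0 <= x < M) F x + \sum_(M <= x < 3 * M) F x
    + \sum_(3 * M <= x < 4 * M) F x.
Proof.
rewrite -(big_mkord xpredT F) NM (@big_cat_nat _ _ _ M) /=; [|lia|lia].
by rewrite (@big_cat_nat _ _ _ (3 * M) M) ?addrA //=; lia.
Qed.

Lemma sum_arc_sign_mul (F : nat -> R) :
  \sum_(j < N.+1) arc_sign j * F j = \sum_(M <= x < 3 * M) F x -
    \sum_(0 <= x < M) F x - \sum_(3 * M <= x < 4 * M) F x.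
Proof.
rewrite (big_split_quarters (fun x => arc_sign x * F x)).
have E a b (c : R) : (forall x, (a <= x < b)%N -> arc_sign x = c) ->
    \sum_(a <= x < b) arc_sign x * F x = c * \sum_(a <= x < b) F x.
  move=> H; rewrite mulr_sumr !big_nat; apply: eq_bigr => x xab.
  by rewrite H.
rewrite (E 0%N M (-1)); last by move=> x ?; rewrite /arc_sign ifF //; lia.
rewrite (E M (3 * M)%N 1); last by move=> x ?; rewrite /arc_sign ifT //; lia.
rewrite (E (3 * M)%N (4 * M)%N (-1)); last by move=> x ?; rewrite /arc_sign ifF //; lia.
by ring.
Qed.

Lemma sum_arc_sign : \sum_(j < N.+1) arc_sign j = 0.
Proof.
have -> : \sum_(j < N.+1) arc_sign j = \sum_(j < N.+1) arc_sign j * 1.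
  by apply: eq_bigr => j _; rewrite mulr1.
rewrite (sum_arc_sign_mul (fun=> 1)) !sumr_const_nat -!natrB; [|lia..].
by have -> : (3 * M - M - (M - 0) - (4 * M - 3 * M) = 0)%N by lia.
Qed.

Lemma sum_pair_poly (K : nat) :
  \sum_(0 <= x < K) (2 * (x%:R - 1) * (4 * M%:R - 1 - x%:R)) =
  - (K%:R - 1) * K%:R * (2 * K%:R - 1) / 3 + 4 * M%:R * K%:R * (K%:R - 1)
  - 2 * (4 * M%:R - 1) * K%:R :> R.
Proof.
elim: K => [|K IH]; first by rewrite big_geq // mulr0n; field.
by rewrite big_nat_recr //= IH -natr1; field.
Qed.

(** The covariance between a crossing and the sign of one of its edges; it tends
    to [1 / 8] as [M] grows. *)
Definition sign_cov : R := (8 * M%:R ^+ 3 - 8 * M%:R + 2) / (4 * M%:R) ^+ 3.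

(** On positive arcs [pair_count] is a quadratic polynomial; the three ranges of
    constant sign are summed in closed form.  The value at arc zero differs from
    the polynomial and is corrected separately. *)
Lemma sum_arc_sign_pair_count :
  \sum_(x < N.+1) arc_sign x * pair_count x = 8 * M%:R ^+ 3 - 8 * M%:R + 2.
Proof.
have M0 : (0 < M)%N by lia.
pose F x : R := 2 * (x%:R - 1) * (4 * M%:R - 1 - x%:R).
have FG x : (0 < x < 4 * M)%N -> pair_count x = F x.
  move=> xM; rewrite /pair_count /F natrM natrM natrB; last by lia.
  have -> : N%:R = 4 * M%:R - 1 :> R by rewrite -[4 * _]natrM -NM -natr1 addrK.
  by have -> : x.-1%:R = x%:R - 1 :> R; [rewrite -subn1 natrB //; lia|ring].
rewrite sum_arc_sign_mul.
have E a b : (0 < a)%N -> (b <= 4 * M)%N ->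
    \sum_(a <= x < b) pair_count x = \sum_(a <= x < b) F x.
  by move=> a0 b4; rewrite !big_nat; apply: eq_bigr => x xab; rewrite FG //; lia.
have C a b : (a <= b)%N ->
    \sum_(a <= x < b) F x = \sum_(0 <= x < b) F x - \sum_(0 <= x < a) F x.
  by move=> ab; rewrite [X in _ = X - _](@big_cat_nat _ _ _ a 0 b) //= addrAC subrr add0r.
have Z : \sum_(0 <= x < M) pair_count x = \sum_(0 <= x < M) F x - F 0%N.
  rewrite !(big_ltn M0) E //; last by lia.
  by rewrite /pair_count mul0n muln0 mulr0n; ring.
rewrite Z !E //; [|lia..].
rewrite (C M (3 * M)%N) ?(C (3 * M)%N (4 * M)%N); [|lia..].
rewrite !sum_pair_poly /F !natrM mulr0n.
by field.
Qed.

Lemma sign_cov_bounds : (5 <= M)%N -> 3 / 25 <= sign_cov <= 1.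
Proof.
move=> M5; have M5R : (5 : R) <= M%:R by rewrite ler_nat.
have p0 : (0 : R) < (4 * M%:R) ^+ 3 by rewrite exprn_gt0 //; lra.
have sq : 25 <= (M%:R : R) ^+ 2 by nra.
have cu : 25 * M%:R <= (M%:R : R) ^+ 3 by rewrite exprS mulrC ler_wpM2l.
rewrite /sign_cov ler_pdivlMr // ler_pdivrMr // exprMn mul1r.
by apply/andP; split; lra.
Qed.

End sector.

(** * Lower bound for the variance *)
Section variance_lower_bound.
Context {R : realType} {n N M : nat} (NM : N.+1 = (4 * M)%N) (e : rel 'I_n).
Context (e_sym : symmetric e) (e_irr : irreflexive e).
Local Notation I := 'I_n.
Local Notation Omega := {ffun 'I_n -> 'I_N.+1}.
Local Notation Q := ((I * I) * (I * I))%type.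
Local Notation m := (#|edges e|%:R : R).
Local Notation Delta := ((max_degree e)%:R : R).
Local Notation X := (@grid_crossings R n e N).
Local Notation adj := (@adj R n e).
Local Notation deg := (@deg R n e).
Local Notation hit := (@hit R n).
Local Notation cross := (@cross R n N).
Local Notation gt0 := (@grid_gt0 N).
Local Notation arc_sign := (@arc_sign R M).
Local Notation sign_cov := (@sign_cov R M).
Implicit Types (u : Omega) (v w x a b c d : I) (p : I * I) (q : Q).

Definition edge_sign p u : R := arc_sign (arc (u p.1) (u p.2)).

Lemma edge_sign_norm p u : `|edge_sign p u| = 1.
Proof. by rewrite /edge_sign /arc_sign; case: ifP => _; rewrite ?normrN normr1. Qed.

Lemma edge_sign_local p v : hit v p = 0 -> invariant_at v (edge_sign p).
Proof.
move=> /eqP; rewrite paddr_eq0 // !pnatr_eq0 !eqb0 => /andP[h1 h2] u t.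
by rewrite /edge_sign !upd_neq.
Qed.

Lemma resample_edge_sign2 p : p.1 != p.2 -> resample p.2 (edge_sign p) = fun=> 0.
Proof.
move=> p12; apply/funext => u; rewrite /resample /avg /edge_sign.
under eq_bigr do rewrite upd_neq // upd_same.
by rewrite (sum_arc (arc_sign) (u p.1)) sum_arc_sign // mul0r.
Qed.

Lemma resample_edge_sign1 p : p.1 != p.2 -> resample p.1 (edge_sign p) = fun=> 0.
Proof.
move=> p12; apply/funext => u; rewrite /resample /avg /edge_sign.
under eq_bigr do rewrite (upd_neq _ _ (_ : p.2 != p.1)) 1?eq_sym // upd_same.
by rewrite (sum_arc_left (arc_sign) (u p.2)) sum_arc_sign // mul0r.
Qed.

Lemma avg_mul_eq0 v (f g : Omega -> R) : invariant_at v f -> resample v g = (fun=> 0) ->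
  avg (fun u => f u * g u) = 0.
Proof.
move=> fv gv; rewrite -(resample_id gt0 fv) -resample_adj gv.
by rewrite (eq_avg (g := fun=> 0)) ?avg_cst ?(Omega_gt0 gt0) // => u; rewrite mulr0.
Qed.

Lemma avg_edge_sign p : p.1 != p.2 -> avg (edge_sign p) = 0.
Proof.
move=> p12; rewrite -(avg_resample gt0 p.2) resample_edge_sign2 //.
by rewrite avg_cst ?(Omega_gt0 gt0).
Qed.

(** The two pairs of [q] have no common vertex; two ends of the same pair may
    still coincide. *)
Definition distinct q : bool :=
  [&& q.1.1 != q.2.1, q.1.1 != q.2.2, q.1.2 != q.2.1 & q.1.2 != q.2.2].

Lemma cross_degenerate q u : ~~ distinct q -> cross q u = 0.
Proof.
move=> qd; rewrite /cross; case: (boolP (interlaced _ _ _ _)) => // /interlaced_neq.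
case=> -[_ h1 h2] [h3 h4 _]; case/negP: qd.
by apply/and4P; split; [apply: contra_neq h1|apply: contra_neq h2|apply: contra_neq h3|apply: contra_neq h4] => ->.
Qed.

(** Average successively over the ends of the second edge, which gives
    [pair_count], and over [b], which gives the sum of
    [sum_arc_sign_pair_count]. *)
Lemma avg_cross_edge_sign a b c d : a != b -> c != d -> distinct ((a, b), (c, d)) ->
  avg (fun u => cross ((a, b), (c, d)) u * edge_sign (a, b) u) = sign_cov.
Proof.
move=> ab cd /and4P[/= ac ad bc bd].
set f := fun u => _.
rewrite -(avg_resample gt0 b) -(avg_resample gt0 c) -(avg_resample gt0 d).
rewrite (resampleC c b) (resampleC d b) (resampleC d c).
rewrite -(avg_cst (Omega_gt0 (I := I) gt0) sign_cov); apply: eq_avg => u.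
transitivity (avg (fun j : 'I_N.+1 => avg (fun k : 'I_N.+1 => avg (fun l : 'I_N.+1 =>
    (interlaced (u a) j k l)%:R * arc_sign (arc (u a) j))))).
  apply: eq_avg => j; apply: eq_avg => k; apply: eq_avg => l.
  rewrite /f /cross /edge_sign /=.
  by rewrite !(upd_same, upd_neq) // eq_sym.
rewrite /avg !card_ord.
have NR : N.+1%:R = 4 * M%:R :> R by rewrite NM natrM.
have M0 : M%:R != 0 :> R by rewrite pnatr_eq0; lia.
rewrite /sign_cov -(sum_arc_sign_pair_count NM).
rewrite -(sum_arc (fun t : nat => arc_sign t * @pair_count R N t) (u a)) NR mulr_suml.
rewrite [RHS]mulr_suml; apply: eq_bigr => j _; rewrite -sum_interlaced.
under eq_bigr do rewrite -mulr_suml -mulrA.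
by rewrite -mulr_suml; field.
Qed.

Lemma cross_flip a b c d : cross ((a, b), (c, d)) = cross ((b, a), (c, d)).
Proof. by apply/funext => u; rewrite /cross /= interlacedC. Qed.

Lemma cross_swap a b c d : cross ((a, b), (c, d)) = cross ((c, d), (a, b)).
Proof. by apply/funext => u; rewrite /cross /= interlaced_swap. Qed.

Lemma cross_bounds q u : 0 <= cross q u <= 1.
Proof. by rewrite /cross; case: (interlaced _ _ _ _); rewrite ?mulr1n ?lexx ?ler01. Qed.

(** For disjoint edges, [inside p q] indicates that [p] is one of the edges of
    [q], and [across p q] that [p] joins an end of one to an end of the other. *)
Definition inside p q : R := hit p.1 q.1 * hit p.2 q.1 + hit p.1 q.2 * hit p.2 q.2.
Definition across p q : R := hit p.1 q.1 * hit p.2 q.2 + hit p.2 q.1 * hit p.1 q.2.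

(** If [p] has an end outside [q], averaging over that end first gives zero.
    Otherwise [p] is one of the two edges of [q], and the covariance is
    [sign_cov], or it joins them, and the trivial bound [-1] is enough because
    such [p] are few. *)
Lemma cross_edge_sign_lower p q : p.1 != p.2 -> q.1.1 != q.1.2 -> q.2.1 != q.2.2 ->
  sign_cov * (distinct q)%:R * inside p q - across p q <= avg (fun u => cross q u * edge_sign p u).
Proof.
case: p q => [x y] [[a b] [c d]] /= xy ab cd.
have across0 : 0 <= across (x, y) ((a, b), (c, d)).
  by rewrite addr_ge0 ?mulr_ge0 ?hit_ge0.
have [qd|qd] := boolP (distinct _); last first.
  rewrite (eq_avg (g := fun=> 0)) => [|u]; last by rewrite cross_degenerate // mul0r.
  by rewrite avg_cst ?(Omega_gt0 gt0) // mulr0 mul0r sub0r oppr_le0.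
have /and4P[/= ac ad bc bd] := qd.
have avg_ge : -1 <= avg (fun u => cross ((a, b), (c, d)) u * edge_sign (x, y) u).
  rewrite -lerN2 opprK -avgN; apply: avg_le; first exact: (Omega_gt0 gt0).
  move=> u; rewrite -mulNr; apply: le_trans (ler_norm _) _; rewrite normrM edge_sign_norm mulr1.
  by have /andP[c0 c1] := cross_bounds ((a, b), (c, d)) u; rewrite normrN ger0_norm.
have far v : v \notin [set a; b; c; d]%SET ->
    [/\ hit v (a, b) = 0, hit v (c, d) = 0 & invariant_at v (cross ((a, b), (c, d)))].
  move=> vq; split; last exact: cross_local.
    move: vq; rewrite !inE !negb_or /hit /= !(eq_sym v) => /andP[/andP[/andP[/negPf-> /negPf->] _] _].
    by rewrite addr0.
  move: vq; rewrite !inE !negb_or /hit /= !(eq_sym v) => /andP[/andP[_ /negPf->] /negPf->].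
  by rewrite addr0.
have [xq|/far[hx1 hx2 hx3]] := boolP (x \in [set a; b; c; d]%SET); last first.
  rewrite (avg_mul_eq0 hx3 (resample_edge_sign1 (p := (x, y)) xy)).
  by rewrite /inside /across /= hx1 hx2; lra.
have [yq|/far[hy1 hy2 hy3]] := boolP (y \in [set a; b; c; d]%SET); last first.
  rewrite (avg_mul_eq0 hy3 (resample_edge_sign2 (p := (x, y)) xy)).
  by rewrite /inside /across /= hy1 hy2; lra.
have [ba dc ca] : [/\ b != a, d != c & c != a] by rewrite !(eq_sym _ a) (eq_sym d) ab cd ac.
have [da cb db] : [/\ d != a, c != b & d != b] by rewrite !(eq_sym _ a) !(eq_sym _ b) ad bc bd.
pose neqs := (negPf ab, negPf cd, negPf ac, negPf ad, negPf bc, negPf bd,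
  (negPf ba, negPf dc, negPf ca, negPf da, negPf cb, negPf db)).
have k1 := avg_cross_edge_sign ab cd qd.
have k2 : avg (fun u => cross ((a, b), (c, d)) u * edge_sign (b, a) u) = sign_cov.
  by rewrite cross_flip avg_cross_edge_sign // /distinct /= bc bd ac ad.
have k3 : avg (fun u => cross ((a, b), (c, d)) u * edge_sign (c, d) u) = sign_cov.
  by rewrite cross_swap avg_cross_edge_sign // /distinct /= ca cb da db.
have k4 : avg (fun u => cross ((a, b), (c, d)) u * edge_sign (d, c) u) = sign_cov.
  by rewrite cross_swap cross_flip avg_cross_edge_sign // /distinct /= da db ca cb.
move: xq yq avg_ge; rewrite !inE -!orbA mulr1n mulr1.
move=> /or4P[]/eqP Ex /or4P[]/eqP Ey; rewrite {}Ex {}Ey in xy *;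
  rewrite ?eqxx // in xy *; rewrite ?k1 ?k2 ?k3 ?k4 /inside /across /hit /= !eqxx !neqs
  ?mulr1n ?mulr0n; lra.
Qed.

Definition edge_sign_sum u : R := \sum_p adj p * edge_sign p u.

Lemma adj_neq p : adj p != 0 -> p.1 != p.2.
Proof. by apply: contra_neq => E; rewrite /adj E e_irr. Qed.

Lemma sum_adj_hit_hit p : adj p = 1 -> \sum_p' adj p' * (hit p'.1 p * hit p'.2 p) = 2.
Proof.
case: p => a b ab; have ab' : a != b by apply: (@adj_neq (a, b)); rewrite ab oner_neq0.
have ba : adj (b, a) = 1 by rewrite adjC.
have aa : adj (a, a) = 0 by rewrite /adj e_irr.
have bb : adj (b, b) = 0 by rewrite /adj e_irr.
rewrite (eq_bigr (fun p' => (p' == (a, b))%:R * adj p' + (p' == (b, a))%:R * adj p' +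
  ((p' == (a, a))%:R * adj p' + (p' == (b, b))%:R * adj p'))).
  by rewrite !big_split /= !sum_delta ab ba aa bb; ring.
move=> [x y] _; rewrite /hit /= !xpair_eqE !(eq_sym a) !(eq_sym b) -!mulnb !natrM.
by ring.
Qed.

Lemma avg_edge_sign_sum : avg edge_sign_sum = 0.
Proof.
rewrite avg_sum big1 // => p _; rewrite avgZ.
by have [->|/adj_neq p12] := eqVneq (adj p) 0; rewrite ?mul0r // avg_edge_sign ?mulr0.
Qed.

Lemma adj01 p : adj p = 0 \/ adj p = 1.
Proof. by rewrite /adj; case: (e _ _); [right|left]. Qed.

(** Signs of different edges are uncorrelated: averaging over an end of one that
    is not an end of the other gives zero. *)
Lemma avg_edge_sign_mul p p' : p'.1 != p'.2 ->
  avg (fun u => edge_sign p u * edge_sign p' u) <= hit p'.1 p * hit p'.2 p.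
Proof.
move=> p12.
have hit01 v : hit v p = 0 \/ 1 <= hit v p.
  rewrite /hit; case: (_ == _); case: (_ == _); [right|right|right|left];
  rewrite ?mulr1n ?mulr0n; lra.
have [h1|h1] := hit01 p'.1.
  by rewrite (avg_mul_eq0 (edge_sign_local h1) (resample_edge_sign1 p12)) h1 mul0r.
have [h2|h2] := hit01 p'.2.
  by rewrite (avg_mul_eq0 (edge_sign_local h2) (resample_edge_sign2 p12)) h2 mulr0.
apply: (@le_trans _ _ 1); last by rewrite -[leLHS]mulr1 ler_pM.
apply: avg_le; first exact: (Omega_gt0 gt0).
by move=> u; apply: le_trans (ler_norm _) _; rewrite normrM !edge_sign_norm mulr1.
Qed.

Lemma msq_edge_sign_sum : msq edge_sign_sum <= 4 * m.
Proof.
have -> : msq edge_sign_sum = \sum_p \sum_p' adj p * adj p' * avg (fun u => edge_sign p u * edge_sign p' u).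
  rewrite /msq; transitivity (avg (fun u => \sum_p \sum_p' adj p * adj p' * (edge_sign p u * edge_sign p' u))).
    apply: eq_avg => u; rewrite expr2 mulr_suml; apply: eq_bigr => p _.
    by rewrite mulr_sumr; apply: eq_bigr => p' _; ring.
  rewrite avg_sum; apply: eq_bigr => p _; rewrite avg_sum; apply: eq_bigr => p' _.
  by rewrite avgZ.
apply: (@le_trans _ _ (\sum_p 2 * adj p)); last first.
  by rewrite -mulr_sumr sum_adj //; lra.
apply: ler_sum => p _; have [p0|p1] := adj01 p.
  by rewrite p0 mulr0 big1 // => p' _; rewrite !mul0r.
rewrite -(sum_adj_hit_hit p1) p1 mulr1; apply: ler_sum => p' _.
rewrite mul1r; have [->|p'1] := adj01 p'; first by rewrite !mul0r.
by rewrite p'1 !mul1r avg_edge_sign_mul // adj_neq // p'1 oner_neq0.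
Qed.

Lemma sum_across : \sum_q adj q.1 * adj q.2 * (\sum_p adj p * across p q) <=
  16 * m * Delta ^+ 2.
Proof.
have -> : \sum_q adj q.1 * adj q.2 * (\sum_p adj p * across p q) =
    \sum_p adj p * (8 * deg p.1 * deg p.2).
  under eq_bigr do rewrite mulr_sumr.
  rewrite exchange_big /=; apply: eq_bigr => p _.
  rewrite (eq_bigr (fun q => adj p * ((adj q.1 * hit p.1 q.1) * (adj q.2 * hit p.2 q.2)) +
     adj p * ((adj q.1 * hit p.2 q.1) * (adj q.2 * hit p.1 q.2)))); last first.
    by move=> q _; rewrite /across; ring.
  rewrite big_split /= -!mulr_sumr.
  rewrite (sum_quads (fun p' => adj p' * hit p.1 p') (fun p' => adj p' * hit p.2 p')).
  rewrite (sum_quads (fun p' => adj p' * hit p.2 p') (fun p' => adj p' * hit p.1 p')).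
  by rewrite !sum_adj_hit //; ring.
have -> : 16 * m * Delta ^+ 2 = \sum_p adj p * (8 * Delta ^+ 2).
  by rewrite -mulr_suml sum_adj //; ring.
apply: ler_sum => p _; rewrite ler_wpM2l ?adj_ge0 //.
have := ler_pM (deg_ge0 e p.1) (deg_ge0 e p.2) (deg_le (R := R) e p.1) (deg_le e p.2).
by lra.
Qed.

Lemma sum_distinct : 4 * m ^+ 2 - 8 * m * Delta <=
  \sum_q adj q.1 * adj q.2 * (distinct q)%:R.
Proof.
have h : \sum_q adj q.1 * adj q.2 * (\sum_v hit v q.1 * hit v q.2) <= 8 * m * Delta.
  have -> : \sum_q adj q.1 * adj q.2 * (\sum_v hit v q.1 * hit v q.2) =
      4 * \sum_v deg v ^+ 2.
    under eq_bigr do rewrite mulr_sumr.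
    rewrite exchange_big mulr_sumr /=; apply: eq_bigr => v _.
    rewrite (eq_bigr (fun q => (adj q.1 * hit v q.1) * (adj q.2 * hit v q.2))); last first.
      by move=> q _; ring.
    rewrite (sum_quads (fun p' => adj p' * hit v p') (fun p' => adj p' * hit v p')).
    by rewrite !sum_adj_hit //; ring.
  by have := sum_deg_sqr (R := R) e_sym e_irr; lra.
have t : \sum_q adj q.1 * adj q.2 = 4 * m ^+ 2.
  by rewrite (sum_quads adj adj) !sum_adj //; ring.
apply: (@le_trans _ _ (\sum_q adj q.1 * adj q.2 * (1 - \sum_v hit v q.1 * hit v q.2))).
  under eq_bigr do rewrite mulrBr mulr1.
  by rewrite sumrB t; lra.
apply: ler_sum => q _; rewrite ler_wpM2l ?mulr_ge0 ?adj_ge0 //.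
have h0 v : 0 <= hit v q.1 * hit v q.2 by rewrite mulr_ge0 ?hit_ge0.
rewrite /distinct; case: q h0 => [[a b] [c d]] /= h0.
have ge1 v : 1 <= hit v (a, b) -> 1 <= hit v (c, d) ->
    1 - \sum_x hit x (a, b) * hit x (c, d) <= 0.
  move=> v1 v2; rewrite subr_le0 (bigD1 v) //= -[leLHS]addr0 lerD //.
    by rewrite -[leLHS]mulr1 ler_pM.
  by rewrite sumr_ge0.
have hit1 x y : 1 <= hit x (x, y) by rewrite /hit /= eqxx mulr1n lerDl.
have hit2 x y : 1 <= hit y (x, y) by rewrite /hit /= eqxx mulr1n lerDr.
have [ac|ac] := eqVneq a c; first by rewrite (ge1 a) // ac.
have [ad|ad] := eqVneq a d; first by rewrite (ge1 a) // ad.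
have [bc|bc] := eqVneq b c; first by rewrite (ge1 b) // bc.
have [bd|bd] := eqVneq b d; first by rewrite (ge1 b) // bd.
by rewrite /= mulr1n lerBlDr lerDl sumr_ge0.
Qed.

(** Nearly all of the [4 * m ^ 2] ordered pairs of edges are disjoint, and each
    of them contributes [4 * sign_cov / 8]. *)
Lemma covariance_lower : 0 <= sign_cov ->
  sign_cov * (2 * m ^+ 2 - 4 * m * Delta) - 2 * m * Delta ^+ 2 <=
  avg (fun u => X u * edge_sign_sum u).
Proof.
move=> cov0.
have -> : avg (fun u => X u * edge_sign_sum u) = 8^-1 * \sum_q adj q.1 * adj q.2 *
    \sum_p adj p * avg (fun u => cross q u * edge_sign p u).
  rewrite -[RHS](_ : avg (fun u => 8^-1 * \sum_q adj q.1 * adj q.2 *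
    \sum_p adj p * (cross q u * edge_sign p u)) = _); last first.
    rewrite avgZ avg_sum; congr (_ * _); apply: eq_bigr => q _.
    rewrite avgZ avg_sum; congr (_ * _); apply: eq_bigr => p _.
    by rewrite avgZ.
  apply: eq_avg => u; rewrite /grid_crossings mulr_suml mulr_sumr; apply: eq_bigr => q _.
  rewrite /crossing_term !mulr_sumr; apply: eq_bigr => p _.
  by ring.
apply: (@le_trans _ _ (8^-1 * \sum_q adj q.1 * adj q.2 *
    (\sum_p adj p * (sign_cov * (distinct q)%:R * inside p q - across p q)))); last first.
  rewrite ler_wpM2l ?invr_ge0 //; apply: ler_sum => q _.
  have [q1|q1] := adj01 q.1; first by rewrite q1 !mul0r.
  have [q2|q2] := adj01 q.2; first by rewrite q2 mulr0 !mul0r.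
  rewrite ler_wpM2l ?mulr_ge0 ?adj_ge0 //; apply: ler_sum => p _.
  have [p1|p1] := adj01 p; first by rewrite p1 !mul0r.
  rewrite ler_wpM2l ?adj_ge0 // cross_edge_sign_lower // adj_neq //.
  - by rewrite p1 oner_neq0.
  - by rewrite q1 oner_neq0.
  - by rewrite q2 oner_neq0.
have -> : \sum_q adj q.1 * adj q.2 *
    (\sum_p adj p * (sign_cov * (distinct q)%:R * inside p q - across p q)) =
    4 * sign_cov * (\sum_q adj q.1 * adj q.2 * (distinct q)%:R)
    - \sum_q adj q.1 * adj q.2 * (\sum_p adj p * across p q).
  rewrite mulr_sumr -sumrB; apply: eq_bigr => q _.
  have [q1|q1] := adj01 q.1; first by rewrite q1 !(mul0r, mulr0) subr0.
  have [q2|q2] := adj01 q.2; first by rewrite q2 !(mul0r, mulr0) subr0.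
  have S : \sum_p adj p * inside p q = 4.
    rewrite /inside; under eq_bigr do rewrite mulrDr.
    by rewrite big_split /= !sum_adj_hit_hit //; ring.
  rewrite (eq_bigr (fun p => sign_cov * (distinct q)%:R * (adj p * inside p q) -
    adj p * across p q)); last by move=> p _; ring.
  by rewrite sumrB -mulr_sumr S; ring.
have h1 := sum_across; have h2 := ler_wpM2l (mulr_ge0 (ler0n R 4) cov0) sum_distinct.
by lra.
Qed.

(** Cauchy-Schwarz against [edge_sign_sum], whose mean square is at most
    [4 * m].  The covariance is close to [m ^ 2 / 4] and at least
    [237 / 1000 * m ^ 2]. *)
Theorem grid_variance : (5 <= M)%N -> (0 < max_degree e)%N ->
  1000 * Delta ^+ 4 <= m -> m ^+ 3 / 81 <= msq (fun u => X u - avg X).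
Proof.
move=> M5 D0 mD; have /andP[c0 c1] := sign_cov_bounds (R := R) M5.
have D1 : 1 <= Delta by rewrite ler1n.
have D14 : Delta <= Delta ^+ 4 by rewrite -{1}[Delta]expr1 ler_weXn2l.
have D24 : Delta ^+ 2 <= Delta ^+ 4 by rewrite ler_weXn2l.
have m0 : 0 < m by apply: lt_le_trans mD; lra.
have cov := covariance_lower (le_trans (divr_ge0 (ler0n _ 3) (ler0n _ 25)) c0).
have cov_lb : 237 / 1000 * m ^+ 2 <= avg (fun u => X u * edge_sign_sum u).
  apply: le_trans cov.
  have h1 : m * Delta <= m ^+ 2 / 1000.
    by rewrite expr2 -mulrA ler_pM2l //; lra.
  have h2 : m * Delta ^+ 2 <= m ^+ 2 / 1000.
    by rewrite expr2 -mulrA ler_pM2l //; lra.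
  have h3 : 0 <= 2 * m ^+ 2 - 4 * m * Delta.
    by have := sqr_ge0 m; lra.
  have h4 := ler_wpM2r h3 c0.
  by have := sqr_ge0 m; lra.
have CS := avg_cauchy_schwarz (fun u => X u - avg X) edge_sign_sum.
have E : avg (fun u => (X u - avg X) * edge_sign_sum u) = avg (fun u => X u * edge_sign_sum u).
  rewrite (eq_avg (g := fun u => X u * edge_sign_sum u - avg X * edge_sign_sum u)).
    by rewrite avgB avgZ avg_edge_sign_sum mulr0 subr0.
  by move=> u; rewrite mulrBl.
rewrite E in CS; rewrite -/(msq _) -/(msq edge_sign_sum) in CS.
set V := msq _ in CS *.
have V0 : 0 <= V by exact: msq_ge0.
have h5 : (237 / 1000 * m ^+ 2) ^+ 2 <= V * (4 * m).
  apply: le_trans (ler_wpM2l V0 msq_edge_sign_sum); apply: le_trans CS.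
  have lb0 : 0 <= 237 / 1000 * m ^+ 2 by have := sqr_ge0 m; lra.
  by apply: lerXn2r (cov_lb); rewrite nnegrE // (le_trans lb0 cov_lb).
have h6 : (237 / 1000) ^+ 2 / 4 * m ^+ 3 <= V.
  rewrite -(ler_pM2r m0); have -> : (237 / 1000) ^+ 2 / 4 * m ^+ 3 * m =
    (237 / 1000 * m ^+ 2) ^+ 2 / 4 by field.
  by lra.
apply: le_trans h6; have m3 : 0 <= m ^+ 3 by rewrite exprn_ge0 // ltW.
by lra.
Qed.

End variance_lower_bound.

(** * From independent positions to a uniform permutation *)
Section random_order.
Context {R : realType} {n : nat} (e : rel 'I_n) (e_sym : symmetric e).
Local Notation I := 'I_n.
Local Notation Q := ((I * I) * (I * I))%type.
Local Notation adj := (@adj R n e).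

(** Common generalisation of the crossing numbers of permutations and of
    positions on the circle: it depends only on the relative order. *)
Definition order_crossings (f : I -> nat) : nat :=
  #|[set q : I * I * I * I | let: (a, b, c, d) := q in
     [&& e a b, e c d, (f c < f a)%N, (f b < f c)%N & (f d < f b)%N]]%SET|.

Lemma order_crossings_perm (s : 'S_n) : order_crossings (fun v => s v) = crossings e s.
Proof. by []. Qed.

Lemma eq_order_crossings (f g : I -> nat) :
  (forall a b, (f a < f b)%N = (g a < g b)%N) -> order_crossings f = order_crossings g.
Proof.
by move=> fg; apply: eq_card => -[[[a b] c] d]; rewrite !inE !fg.
Qed.

Lemma order_crossings_le f : (order_crossings f <= n ^ 4)%N.
Proof.
apply: leq_trans (max_card _) _; rewrite !card_prod card_ord.
by rewrite !expnS expn0 muln1 !mulnA.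
Qed.

Section grid.
Context {N : nat}.
Local Notation Omega := {ffun I -> 'I_N.+1}.
Implicit Types (u : Omega).

Let chainq (q : Q) u : R := (chain (u q.1.1) (u q.1.2) (u q.2.1) (u q.2.2))%:R.

Lemma sum_adj_involution (h : Q -> Q) (G : Q -> R) : involutive h ->
  (forall q, adj (h q).1 * adj (h q).2 = adj q.1 * adj q.2) ->
  \sum_q adj q.1 * adj q.2 * G (h q) = \sum_q adj q.1 * adj q.2 * G q.
Proof.
move=> hK hadj; rewrite [RHS](reindex_inj (inv_inj hK)) /=.
by apply: eq_bigr => q _; rewrite hadj.
Qed.

(** The eight chains of [interlacedE] are exchanged by flipping either edge and
    by swapping the two, which preserve the weights. *)
Lemma grid_crossingsE u : grid_crossings e u = (order_crossings (fun v => u v))%:R :> R.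
Proof.
have -> : (order_crossings (fun v => u v))%:R = \sum_q adj q.1 * adj q.2 * chainq q u.
  rewrite /order_crossings -sum1_card natr_sum big_mkcond /=.
  pose h (q : I * I * I * I) : Q := ((q.1.1.1, q.1.1.2), (q.1.2, q.2)).
  pose h' (q : Q) := (q.1.1, q.1.2, q.2.1, q.2.2).
  rewrite [RHS](reindex h) /=; last by exists h' => [[[[a b] c] d]|[[a b] [c d]]].
  apply: eq_bigr => -[[[a b] c] d] _; rewrite inE /= /adj /chainq /chain /=.
  case: (e a b); case: (e c d); rewrite /= ?mulr1n ?mulr0n ?mulr0 ?mul0r ?mul1r //.
  by case: ifP.
rewrite /grid_crossings -mulr_sumr.
pose f1 (q : Q) : Q := ((q.1.2, q.1.1), q.2).
pose f2 (q : Q) : Q := (q.1, (q.2.2, q.2.1)).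
pose f3 (q : Q) : Q := (q.2, q.1).
have adjf1 q : adj (f1 q).1 * adj (f1 q).2 = adj q.1 * adj q.2.
  by case: q => -[a b] [c d]; rewrite /= (adjC e_sym b).
have adjf2 q : adj (f2 q).1 * adj (f2 q).2 = adj q.1 * adj q.2.
  by case: q => -[a b] [c d]; rewrite /= (adjC e_sym d).
have adjf3 q : adj (f3 q).1 * adj (f3 q).2 = adj q.1 * adj q.2 by rewrite mulrC.
have s1 G : \sum_q adj q.1 * adj q.2 * G (f1 q) = \sum_q adj q.1 * adj q.2 * G q.
  by apply: sum_adj_involution adjf1 => -[[a b] [c d]].
have s2 G : \sum_q adj q.1 * adj q.2 * G (f2 q) = \sum_q adj q.1 * adj q.2 * G q.
  by apply: sum_adj_involution adjf2 => -[[a b] [c d]].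
have s3 G : \sum_q adj q.1 * adj q.2 * G (f3 q) = \sum_q adj q.1 * adj q.2 * G q.
  by apply: sum_adj_involution adjf3 => -[[a b] [c d]].
pose G q := chainq q u.
have crossE q : cross q u = G q + G (f1 q) + G (f2 q) + G (f1 (f2 q)) + G (f3 q) +
    G (f3 (f2 q)) + G (f3 (f1 q)) + G (f3 (f1 (f2 q))).
  by rewrite /cross -[(nat_of_bool _)%:R](congr1 (fun k => k%:R) (esym (interlacedE _ _ _ _))) !natrD.
under eq_bigr do rewrite crossE !mulrDr.
rewrite !big_split /= (s1 G) (s2 G) (s2 (G \o f1)) (s3 G) (s2 (G \o f3)) (s1 (G \o f3)).
rewrite (s2 (G \o f3 \o f1)) /= (s1 G) (s3 G) (s1 (G \o f3)) /= (s3 G).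
by lra.
Qed.

Lemma avg_comp_perm (f : Omega -> R) (s : 'S_n) :
  avg (fun u : Omega => f [ffun v => u (s v)]) = avg f.
Proof.
rewrite /avg; congr (_ / _); rewrite [RHS](reindex_inj (h := fun u => [ffun v => u (s v)])) //.
move=> u u' /ffunP uu; apply/ffunP => v; have := uu (s^-1%g v).
by rewrite !ffunE permKV.
Qed.

(** Distinct positions have the order of their ranks, and composition with the
    rank permutation is a bijection of the permutations. *)
Lemma sum_order_crossings_comp (F : nat -> R) u : injective u ->
  \sum_(s : 'S_n) F (order_crossings (fun v => u (s v))) =
  \sum_(s : 'S_n) F (crossings e s).
Proof.
move=> u_inj; pose below v := [set w : I | (u w < u v)%N]%SET.
have rank_lt v : (#|below v| < n)%N.
  rewrite -[X in (_ < X)%N]card_ord; apply: proper_card.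
  by apply/properP; split; [exact/fintype.subsetP|exists v; rewrite // inE ltnn].
pose rank v := Ordinal (rank_lt v).
have rank_mono v w : (rank v < rank w)%N = (u v < u w)%N.
  have incl x y : (u x <= u y)%N -> (#|below x| <= #|below y|)%N.
    move=> xy; apply/subset_leq_card/fintype.subsetP => t; rewrite !inE => tx.
    exact: leq_trans tx xy.
  have [vw|wv] := ltnP (u v) (u w); last by rewrite /= ltnNge incl.
  apply: proper_card; apply/properP; split; last by exists v; rewrite inE ?ltnn.
  by apply/fintype.subsetP => t; rewrite !inE => tv; exact: ltn_trans tv vw.
have rank_inj : injective rank.
  move=> v w vw; apply: u_inj; apply: val_inj; apply/eqP.
  have := rank_mono v w; have := rank_mono w v; rewrite vw ltnn.
  by case: ltngtP.
rewrite [RHS](reindex_inj (mulIg (perm rank_inj))) /=; apply: eq_bigr => s _.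
congr F; rewrite -order_crossings_perm; apply: eq_order_crossings => a b.
by rewrite !permM !permE rank_mono.
Qed.

Lemma perm_card_gt0 : (0 < #|{: 'S_n}|)%N.
Proof. by apply/card_gt0P; exists 1%g. Qed.

Lemma avg_noninjective : avg (fun u : Omega => (~~ injectiveb u)%:R) <= (n ^ 2)%N%:R / N.+1%:R :> R.
Proof.
have gt0 := grid_gt0 (N := N).
apply: (@le_trans _ _ (avg (fun u : Omega => \sum_(p : I * I | p.1 != p.2) (u p.1 == u p.2)%:R))).
  apply: ler_avg => u; case: (boolP (injectiveb u)) => [_|/injectivePn[v [w vw uvw]]].
    by rewrite sumr_ge0.
  by rewrite (bigD1 (v, w)) //= uvw eqxx mulr1n lerDl sumr_ge0.
rewrite avg_sum; apply: (@le_trans _ _ (\sum_(p : I * I | p.1 != p.2) N.+1%:R^-1)).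
  apply: ler_sum => p p12; rewrite -(avg_resample gt0 p.2).
  apply: avg_le; first exact: (Omega_gt0 gt0).
  move=> u; rewrite /resample /avg card_ord.
  under eq_bigr do rewrite upd_same upd_neq // eq_sym -[(_ == _)%:R]mulr1.
  by rewrite (sum_delta (u p.1) (fun=> 1)) mul1r.
rewrite sumr_const -[leLHS]mulr_natl ler_wpM2r ?invr_ge0 // ler_nat.
by apply: leq_trans (max_card _) _; rewrite card_prod card_ord.
Qed.

(** Independent uniform positions are invariant under permuting the vertices.
    Averaging over these permutations first shows that, restricted to distinct
    positions, [F] of the crossing number has the same mean as under the uniform
    permutation. *)
Lemma avg_grid_perm (F : nat -> R) (B : R) : (forall k, (k <= n ^ 4)%N -> `|F k| <= B) ->
  `|avg (fun u : Omega => F (order_crossings (fun v => u v))) - avg (fun s : 'S_n => F (crossings e s))|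
  <= 2 * B * ((n ^ 2)%N%:R / N.+1%:R).
Proof.
move=> FB; have gt0 := grid_gt0 (N := N).
have B0 : 0 <= B by rewrite (le_trans _ (FB 0%N _)).
set A := avg (fun s : 'S_n => _).
have AB : `|A| <= B.
  by apply: (avg_norm_le perm_card_gt0) => s; apply: FB; rewrite -order_crossings_perm order_crossings_le.
pose D (u : Omega) := F (order_crossings (fun v => u v)) - A.
have D_inj : avg (fun u => D u * (injectiveb u)%:R) = 0.
  rewrite -(avg_cst perm_card_gt0 (avg (fun u => D u * (injectiveb u)%:R))).
  transitivity (avg (fun s : 'S_n => avg (fun u : Omega =>
     D [ffun v => u (s v)] * (injectiveb u)%:R))).
    apply: eq_avg => s; rewrite -(avg_comp_perm _ s); apply: eq_avg => u; congr (_ * _%:R).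
    congr nat_of_bool; apply/injectiveP/injectiveP => u_inj v w.
      by move=> uvw; apply: (can_inj (permKV s)); apply: u_inj; rewrite !ffunE !permKV.
    by rewrite !ffunE => /u_inj/perm_inj.
  rewrite exchange_avg -[RHS](avg_cst (Omega_gt0 (I := I) gt0)); apply: eq_avg => u.
  rewrite avgZr; case: injectiveP => [u_inj|_]; last by rewrite mulr0.
  rewrite mulr1 /D avgB avg_cst ?perm_card_gt0 //.
  apply/eqP; rewrite subr_eq0; apply/eqP; rewrite /A /avg; congr (_ / _).
  rewrite -(sum_order_crossings_comp F u_inj); apply: eq_bigr => s _; congr F.
  by apply: eq_order_crossings => a b; rewrite !ffunE.
have -> : avg (fun u : Omega => F (order_crossings (fun v => u v))) - A =
    avg (fun u => D u * (~~ injectiveb u)%:R).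
  rewrite -[LHS]subr0 -D_inj -[X in _ - X - _](avg_cst (Omega_gt0 (I := I) gt0)) -!avgB.
  by apply: eq_avg => u; rewrite /D; case: injectiveb; rewrite /= ?mulr1n ?mulr0n; ring.
apply: le_trans (ler_norm_avg _) _.
apply: le_trans (ler_wpM2l _ avg_noninjective); last by rewrite mulr_ge0.
rewrite -avgZ; apply: ler_avg => u; rewrite normrM [`|_%:R|]ger0_norm // ler_wpM2r //.
apply: le_trans (ler_normB _ _) _.
by have := FB _ (order_crossings_le (fun v => u v)); lra.
Qed.

End grid.
End random_order.

(** * Passage to the limit *)
Section limit.
Context {R : realType} {n : nat} (e : rel 'I_n).
Context (e_sym : symmetric e) (e_irr : irreflexive e).
Local Notation m := (#|edges e|%:R : R).
Local Notation Delta := ((max_degree e)%:R : R).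
Local Notation grid k := {ffun 'I_n -> 'I_(4 * k + 3).+1}.

Lemma avg_grid_cvg (F : nat -> R) :
  (fun k => avg (fun u : grid k => F (order_crossings e (fun v => u v)))) @ \oo -->
  avg (fun s : 'S_n => F (crossings e s)).
Proof.
pose B := \sum_(0 <= k < (n ^ 4).+1) `|F k|.
have FB k : (k <= n ^ 4)%N -> `|F k| <= B.
  move=> kn; rewrite /B big_mkord (bigD1 (Ordinal (kn : (k < (n ^ 4).+1)%N))) //=.
  by rewrite lerDl sumr_ge0.
have B0 : 0 <= B by rewrite sumr_ge0.
pose C := 2 * B * (n ^ 2)%N%:R.
apply/cvgrPdist_le => eps eps0; near=> k.
rewrite distrC; apply: le_trans (avg_grid_perm e FB) _.
rewrite mulrA -/C ler_pdivrMr // mulrC -ler_pdivrMr //.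
apply: (@le_trans _ _ k%:R); first by near: k; exact: nbhs_infty_ger.
by rewrite ler_nat; lia.
Unshelve. all: by end_near. Qed.

Lemma avg_grid_crossings_cvg (F : R -> R) :
  (fun k => avg (fun u : grid k => F (grid_crossings e u))) @ \oo -->
  avg (fun s : 'S_n => F (crossings e s)%:R).
Proof.
have -> : (fun k => avg (fun u : grid k => F (grid_crossings e u))) =
    fun k => avg (fun u : grid k => (F \o (fun j => j%:R)) (order_crossings e (fun v => u v))).
  by apply/funext => k; apply: eq_avg => u; rewrite grid_crossingsE.
exact: avg_grid_cvg.
Qed.

Lemma msq_centered (A : finType) (f : A -> R) : (0 < #|A|)%N ->
  avg (fun a => (f a - avg f) ^+ 2) = avg (fun a => f a ^+ 2) - avg f ^+ 2.
Proof.
move=> A0; set mu := avg f.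
rewrite (eq_avg (g := fun a => f a ^+ 2 - 2 * mu * f a + mu ^+ 2)); last by move=> a; ring.
by rewrite avgD avgB avgZ avg_cst // -/mu; ring.
Qed.

(** On the circle with [4 * k.+1] points the two previous theorems give the bound
    with the mean and variance of that model, which converge together with the
    distribution function; [Phi] is continuous.  The constant is
    [15 * 81 + 18 * 9 = 1377]. *)
Theorem permutation_berry_esseen (t : R) : (0 < max_degree e)%N ->
  1000 * Delta ^+ 4 <= m ->
  let X (s : 'S_n) : R := (crossings e s)%:R in
  let V := avg (fun s => (X s - avg X) ^+ 2) in
  0 < V ->
  `|avg (fun s => (X s <= t)%R%:R) - Phi ((t - avg X) / Num.sqrt V)| <=
    1377 * Delta ^+ 2 / Num.sqrt m.
Proof.
move=> D0 mD X V V0.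
have D1 : 1 <= Delta by rewrite ler1n.
have D4 : 1 <= Delta ^+ 4 by rewrite exprn_ege1.
have m0 : 0 < m by apply: lt_le_trans mD; lra.
pose mu_ k := avg (fun u : grid k => grid_crossings (R := R) e u).
pose V_ k := avg (fun u : grid k => (grid_crossings (R := R) e u - mu_ k) ^+ 2).
pose a_ k := avg (fun u : grid k => (grid_crossings (R := R) e u <= t)%R%:R : R).
have mu_cvg : mu_ @ \oo --> avg X by exact: (@avg_grid_crossings_cvg id).
have a_cvg : a_ @ \oo --> avg (fun s => (X s <= t)%R%:R : R).
  exact: (@avg_grid_crossings_cvg (fun x => (x <= t)%R%:R)).
have V_cvg : V_ @ \oo --> V.
  rewrite /V (msq_centered _ (perm_card_gt0 (n := n))).
  have -> : V_ = (fun k => avg (fun u : grid k => grid_crossings (R := R) e u ^+ 2)) - (mu_ \* mu_).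
    apply/funext => k; rewrite /V_ /mu_ msq_centered ?expr2 //.
    by apply: Omega_gt0; exact: grid_gt0.
  apply: cvgB; first exact: (@avg_grid_crossings_cvg (fun x => x ^+ 2)).
  by rewrite expr2; apply: cvgM.
have S_cvg : (fun k => Num.sqrt (V_ k)) @ \oo --> Num.sqrt V.
  by apply: (cvg_comp V_ Num.sqrt); [exact: V_cvg|exact: sqrt_continuous].
have Phi_cont : continuous (@Phi R) := is_derive1_continuous is_derive_Phi.
have z_cvg : (fun k => (t - mu_ k) / Num.sqrt (V_ k)) @ \oo --> (t - avg X) / Num.sqrt V.
  apply: cvgM; first by apply: cvgB => //; exact: cvg_cst.
  by apply: cvgV => //; rewrite gt_eqF // sqrtr_gt0.
have P_cvg : (fun k => Phi ((t - mu_ k) / Num.sqrt (V_ k))) @ \oo -->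
    Phi ((t - avg X) / Num.sqrt V).
  by apply: (cvg_comp _ (@Phi R)); [exact: z_cvg|exact: Phi_cont].
have L_cvg : (fun k => `|a_ k - Phi ((t - mu_ k) / Num.sqrt (V_ k))|) @ \oo -->
    `|avg (fun s => (X s <= t)%R%:R) - Phi ((t - avg X) / Num.sqrt V)|.
  by apply: cvg_norm; apply: cvgB; [exact: a_cvg|exact: P_cvg].
rewrite -(cvg_lim (@Rhausdorff R) L_cvg).
apply: limr_le; first exact: cvgP L_cvg.
exists 4%N => // k /= k4.
have NM : ((4 * k + 3).+1 = 4 * k.+1)%N by lia.
have V_ge : m ^+ 3 / 81 <= V_ k := grid_variance NM e_sym e_irr k4 D0 mD.
have Vk0 : 0 < V_ k by apply: lt_le_trans V_ge; rewrite divr_gt0 // exprn_gt0.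
have s0 : 0 < Num.sqrt (V_ k) by rewrite sqrtr_gt0.
have s2 : Num.sqrt (V_ k) ^+ 2 = V_ k by rewrite sqr_sqrtr // ltW.
have := grid_berry_esseen e_sym e_irr ((t - mu_ k) / Num.sqrt (V_ k)) s0 s2.
rewrite -/(mu_ k).
have -> : avg (fun u : grid k => ((grid_crossings (R := R) e u - mu_ k) / Num.sqrt (V_ k) <=
    (t - mu_ k) / Num.sqrt (V_ k))%R%:R) = a_ k.
  by apply: eq_avg => u; rewrite ler_pM2r ?invr_gt0 // lerD2r.
move=> /le_trans; apply.
set r := Num.sqrt m; have r0 : 0 < r by rewrite sqrtr_gt0.
have r2 : r ^+ 2 = m by rewrite sqr_sqrtr // ltW.
have sr : r ^+ 3 / 9 <= Num.sqrt (V_ k).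
  rewrite -(@ler_pXn2r _ 2) ?nnegrE ?divr_ge0 ?exprn_ge0 ?(ltW r0) ?(ltW s0) //.
  rewrite s2; apply: le_trans V_ge; rewrite le_eqVlt; apply/orP; left; apply/eqP.
  by rewrite -r2; field.
have h1 : 15 * (m ^+ 2 * r * Delta ^+ 2) / Num.sqrt (V_ k) ^+ 2 <= 1215 * Delta ^+ 2 / r.
  rewrite s2 ler_pdivrMr // [leRHS]mulrAC ler_pdivlMr //.
  have cD : 0 <= 1215 * Delta ^+ 2 by have := sqr_ge0 Delta; lra.
  have := ler_wpM2l cD V_ge.
  by rewrite -r2 => h; apply: le_trans h; rewrite le_eqVlt; apply/orP; left; apply/eqP; field.
have h2 : 18 * (m * Delta ^+ 2) / Num.sqrt (V_ k) <= 162 * Delta ^+ 2 / r.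
  rewrite ler_pdivrMr // [leRHS]mulrAC ler_pdivlMr //.
  have cD : 0 <= 162 * Delta ^+ 2 by have := sqr_ge0 Delta; lra.
  have := ler_wpM2l cD sr.
  by rewrite -r2 => h; apply: le_trans h; rewrite le_eqVlt; apply/orP; left; apply/eqP; field.
have -> : 1377 * Delta ^+ 2 / r = 1215 * Delta ^+ 2 / r + 162 * Delta ^+ 2 / r by ring.
exact: lerD.
Qed.

End limit.

(** * Random permutations on an abstract probability space *)
Section uniform_law.
Context {R : realType} {n : nat} {d : measure_display} {Omega : measurableType d}.
Context (P : probability Omega R) (p : {RV P >-> 'S_n}).
Context (p_unif : uniform_permutation p).

Lemma integral_uniform (F : 'S_n -> R) : (forall s, 0 <= F s) ->
  (\int[P]_w (F (p w))%:E = (avg F)%:E)%E.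
Proof.
move=> F0.
have mp (s : 'S_n) : measurable (p @^-1` [set s]).
  by rewrite -[X in measurable X]setTI; apply: (measurable_funP p).
transitivity (\int[P]_w (\sum_(s : 'S_n) (F s)%:E * (\1_(p @^-1` [set s]) w)%:E))%E.
  apply: eq_integral => w _; rewrite (bigD1 (p w)) //= big1 ?adde0.
    by rewrite indicE mem_set ?mule1.
  move=> s sp; rewrite indicE memNset ?mule0 //= => ps.
  by rewrite ps eqxx in sp.
rewrite ge0_integral_sum //=; last 2 first.
- move=> s; apply/measurable_EFinP; exact: measurable_funM.
- by move=> s w _; rewrite -EFinM lee_fin mulr_ge0.
rewrite /avg mulr_suml -sumEFin; apply: eq_bigr => s _.
rewrite ge0_integralZl_EFin //; last first.
  by apply/measurable_EFinP; exact: measurable_indic.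
rewrite integral_indic // setIT EFinM; congr (_ * _)%E.
by rewrite card_Sn; exact: p_unif.
Qed.

Lemma probability_uniform (g : 'S_n -> bool) :
  P [set w | g (p w)] = (avg (fun s => (g s)%:R : R))%:E.
Proof.
rewrite -(@integral_uniform (fun s => (g s)%:R)) //.
have mg : measurable [set w | g (p w)].
  rewrite (_ : [set w | g (p w)] = p @^-1` [set s | g s]) //.
  by rewrite -[X in measurable X]setTI; apply: (measurable_funP p).
rewrite -[LHS]/(P _) -[X in P X]setIT -integral_indic //; apply: eq_integral => w _.
rewrite indicE; congr (_%:R%:E); congr nat_of_bool.
by apply/idP/idP; rewrite inE.
Qed.

Lemma expectation_uniform (F : 'S_n -> R) : (forall s, 0 <= F s) ->
  fine ('E_P[(fun w => F (p w))])%E = avg F.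
Proof. by move=> F0; rewrite unlock integral_uniform. Qed.

Lemma variance_uniform (F : 'S_n -> R) : (forall s, 0 <= F s) ->
  fine ('V_P[(fun w => F (p w))])%E = avg (fun s => (F s - avg F) ^+ 2).
Proof.
move=> F0; rewrite /variance unlock expectation_uniform //.
rewrite -(@expectation_uniform (fun s => (F s - avg F) ^+ 2)) //.
  by move=> s; rewrite sqr_ge0.
Qed.

End uniform_law.

Lemma max_degree_le_edges (R : realType) (n : nat) (e : rel 'I_n) :
  symmetric e -> irreflexive e -> (max_degree e)%:R <= 2 * #|edges e|%:R :> R.
Proof.
move=> e_sym e_irr; rewrite -(sum_deg e_sym e_irr) -natr_sum ler_nat. apply/bigmax_leqP => v _.
by rewrite (bigD1 v) //= leq_addr.
Qed.

(** The Kolmogorov distance never exceeds one, which covers the graphs with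
    [m < 1000 * Delta ^ 4]. *)
Theorem crossings_berry_esseen (R : realType) (n : nat) (e : rel 'I_n)
    (e_sym : symmetric e) (e_irr : irreflexive e)
    (d : measure_display) (Omega : measurableType d) (P : probability Omega R)
    (p : {RV P >-> 'S_n}) (p_unif : uniform_permutation p)
    (d' : measure_display) (Omega' : measurableType d')
    (Q : probability Omega' R)
    (Z : {RV Q >-> R}) (Z_normal : standard_normal Z) :
  let X : Omega -> R := fun w => (crossings e (p w))%:R in
  let mu : R := fine ('E_P[X])%E in
  let sigma : R := Num.sqrt (fine ('V_P[X])%E) in
  0 < sigma -> (0 < max_degree e)%N ->
  kolmogorov_distance P Q (fun w => (X w - mu) / sigma) Z <=
    1377 * (max_degree e)%:R ^+ 2 / Num.sqrt #|edges e|%:R.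
Proof.
move=> X mu sigma sigma0 D0.
pose XS (s : 'S_n) : R := (crossings e s)%:R.
pose V := avg (fun s => (XS s - avg XS) ^+ 2).
have muE : mu = avg XS by exact: (expectation_uniform p_unif (F := XS)).
have sE : sigma = Num.sqrt V.
  by congr Num.sqrt; exact: (variance_uniform p_unif (F := XS)).
have V0 : 0 < V by rewrite -sqrtr_gt0 -sE.
set D : R := (max_degree e)%:R; set m : R := #|edges e|%:R.
have D1 : 1 <= D by rewrite ler1n.
have m0 : 0 < m.
  by have := max_degree_le_edges R e_sym e_irr; rewrite -/D -/m; lra.
have r0 : 0 < Num.sqrt m by rewrite sqrtr_gt0.
apply: ge_sup; first by exists (`|fine (P [set w | (X w - mu) / sigma <= 0]) - fine (Q [set w | Z w <= 0])|); exists 0.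
move=> _ [x _ <-].
have PE : fine (P [set w | (X w - mu) / sigma <= x]) =
    avg (fun s => (XS s <= avg XS + sigma * x)%R%:R : R).
  rewrite (probability_uniform p_unif (fun s => (XS s - mu) / sigma <= x)).
  by apply: eq_avg => s; rewrite ler_pdivrMr // muE lerBlDl mulrC.
have QE : fine (Q [set w | Z w <= x]) = Phi x.
  rewrite /Phi; have /= <- := Z_normal `]-oo, x]%classic (measurable_itv _).
  by congr (fine (Q _)); apply/seteqP; split => w /=; rewrite in_itv.
rewrite PE QE; have [mD|mD] := leP (1000 * D ^+ 4) m.
  have zE : (avg XS + sigma * x - avg XS) / Num.sqrt V = x.
    by rewrite -sE; field; rewrite gt_eqF.
  by rewrite -[X in Phi X]zE; exact: permutation_berry_esseen.
apply: (@le_trans _ _ 1).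
  have a1 : 0 <= avg (fun s => (XS s <= avg XS + sigma * x)%R%:R : R) <= 1.
    rewrite avg_ge0 // avg_le ?perm_card_gt0 // => s.
    by rewrite (ler_nat _ _ 1) leq_b1.
  have := Phi_ge0 x; have := Phi_le1 x.
  by rewrite ler_norml => h1 h2; move/andP: a1 => [h3 h4]; apply/andP; split; lra.
rewrite ler_pdivlMr // mul1r.
have c0 : 0 <= 1377 * D ^+ 2 by have := sqr_ge0 D; lra.
have D4 : 0 <= D ^+ 4 by rewrite exprn_even_ge0.
rewrite -[leRHS](ger0_norm c0) -sqrtr_sqr; apply: ler_wsqrtr.
apply: le_trans (ltW mD) _; rewrite exprMn -exprM.
have c2 : 1000 <= 1377 ^+ 2 :> R by rewrite expr2; lra.
exact: ler_wpM2r.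
Qed.

(** Since [sqrt 5 >= 2] and [sqrt 10 >= 3], both right-hand sides are above
    [1377 * Delta ^ 2 / sqrt m]. *)
Theorem theorem1p1 (R : realType) (n : nat) (e : rel 'I_n)
    (e_sym : symmetric e) (e_irr : irreflexive e)
    (d : measure_display) (Omega : measurableType d) (P : probability Omega R)
    (p : {RV P >-> 'S_n}) (p_unif : uniform_permutation p)
    (d' : measure_display) (Omega' : measurableType d')
    (Q : probability Omega' R)
    (Z : {RV Q >-> R}) (Z_normal : standard_normal Z) :
  let m := #|edges e| in
  let Delta := max_degree e in
  let X : Omega -> R := fun w => (crossings e (p w))%:R in
  let mu : R := fine ('E_P[X])%E in
  let sigma : R := Num.sqrt (fine ('V_P[X])%E) in
  let W : Omega -> R := fun w => (X w - mu) / sigma in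
  0 < sigma ->
  (Delta \in [:: 1%N; 2%N] ->
     kolmogorov_distance P Q W Z <=
       1 / Num.sqrt m%:R *
       (60 * (1 + 9 * Num.sqrt 5) * Delta%:R ^+ 2 + 600 * Delta%:R)) /\
  ((3 <= Delta)%N ->
     kolmogorov_distance P Q W Z <=
       1 / Num.sqrt m%:R *
       (120 * (1 + 9 * Num.sqrt 10) * Delta%:R ^+ 2 + 1200 * Delta%:R)).
Proof.
move=> m Delta X mu sigma W sigma0.
have le_sqrt (a b : nat) : (a ^ 2 <= b)%N -> (a%:R : R) <= Num.sqrt b%:R.
  move=> ab; rewrite -[leLHS]ger0_norm // -sqrtr_sqr ler_wsqrtr // -natrX ler_nat.
  exact: ab.
have sqrt5 := le_sqrt 2%N 5%N isT; have sqrt10 := le_sqrt 3%N 10%N isT.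
have bound (c : R) : (0 < Delta)%N -> 1377 * Delta%:R ^+ 2 <= c ->
    kolmogorov_distance P Q W Z <= 1 / Num.sqrt m%:R * c.
  move=> D0 Dc; apply: le_trans (crossings_berry_esseen e_sym e_irr p_unif Z_normal sigma0 D0) _.
  by rewrite mul1r mulrC ler_wpM2l // invr_ge0 sqrtr_ge0.
split=> [|D3].
  rewrite !inE => /orP[]/eqP D; apply: bound; rewrite ?D // ?mulr1n; lra.
apply: bound; first exact: leq_trans D3.
have := sqr_ge0 (Delta%:R : R); have := ler0n R Delta; nra.
Qed.
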